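(* 1) Let $\mathfrak g=\mathfrak{vect}(0|n)$ with $n>2$, or $\mathfrak g=\mathfrak{svect}(0|n)$ with $n>2$, or $\mathfrak g=\mathfrak h(0|n)$ with $n>4$. Let $\mathfrak s_0$ be a maximal solvable Lie subalgebra of $\mathfrak g_0$, and let $\mathfrak{msc}^{\mathfrak g}:=(\mathfrak g_{-1},\mathfrak s_0)_*$ be the prolong of $\mathfrak g_{-1}\oplus\mathfrak s_0$ in $\mathfrak g$. Then the Lie superalgebra $\mathfrak{msc}^{\mathfrak g}$ is maximal solvable in $\mathfrak g$. 2) Let $\mathfrak g=\widetilde{\mathfrak{svect}}(0|2n)$ with $n\ge2$. There are no maximal solvable Lie subsuperalgebras $\mathfrak s$ of $\mathfrak g$ with $\mathfrak s_{-1}=\mathfrak g_{-1}$.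
   Context: The ground field is $\mathbb C$; all spaces are finite-dimensional. $\Lambda(n)$ is the Grassmann algebra on generators $\xi_1,\dots,\xi_n$, graded by $\deg\xi_i=1$, with parity $p$ equal to the degree modulo 2. $\mathfrak{vect}(0|n)$ is the Lie superalgebra of superderivations $\sum f_i\partial_i$ of $\Lambda(n)$, where $f_i\in\Lambda(n)$ and $\partial_i\xi_j=\delta_{ij}$, with $\mathbb Z$-grading $\deg(f\partial_i)=\deg f-1$. $\mathfrak{svect}(0|n)=\{D\in\mathfrak{vect}(0|n)\mid \mathrm{Div}\,D=0\}$, where $\mathrm{Div}(\sum f_i\partial_i)=\sum(-1)^{p(f_i)}\partial_i(f_i)$, with the induced grading. For $n=2k+l$, write the generators of $\Lambda(n)$ as $\xi_1,\dots,\xi_k,\eta_1,\dots,\eta_k,\zeta_1,\dots,\zeta_l$. Then $\mathfrak h(0|n)=\mathrm{Span}\{H_f\mid f\in\Lambda(n)\}$, where $$H_f=(-1)^{p(f)}\Bigl(\sum_{i\le k}\bigl(\tfrac{\partial f}{\partial\xi_i}\partial_{\eta_i}+\tfrac{\partial f}{\partial\eta_i}\partial_{\xi_i}\bigr)+\sum_{j\le l}\tfrac{\partial f}{\partial\zeta_j}\partial_{\zeta_j}\Bigr),$$ with $\deg H_f=\deg f-2$ for homogeneous non-constant $f$. With $2n$ generators $\xi_1,\dots,\xi_{2n}$ and $\Xi=\xi_1\cdots\xi_{2n}$, put $\widetilde{\mathfrak{svect}}(0|2n)=(1+\Xi)\,\mathfrak{svect}(0|2n)\subset\mathfrak{vect}(0|2n)$.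 It is $\mathbb Z/2n\mathbb Z$-graded with degrees represented by $-1,0,\dots,2n-2$: the degree $-1$ component is $\mathrm{Span}((1+\Xi)\partial_1,\dots,(1+\Xi)\partial_{2n})$, and the degree $i$ component is $\mathfrak{svect}_i(0|2n)$ for $i\ge0$. A Lie subsuperalgebra $\mathfrak s\subset\mathfrak g$ is graded if $\mathfrak s=\bigoplus_i\mathfrak s_i$ with $\mathfrak s_i=\mathfrak s\cap\mathfrak g_i$. ''Maximal solvable in $\mathfrak g$'' means: solvable, graded, and not properly contained in any graded solvable Lie subsuperalgebra of $\mathfrak g$. Prolong: for a non-zero subspace $\mathfrak b_{-1}\subset\mathfrak g_{-1}$ and a subalgebra $\mathfrak b_0\subset\mathfrak g_0$ preserving $\mathfrak b_{-1}$, $(\mathfrak b_{-1},\mathfrak b_0)_*:=\bigoplus_{k\ge-1}\mathfrak b_k$, where for $k\ge1$ recursively $\mathfrak b_k:=\{D\in\mathfrak g_k\mid[D,\mathfrak b_{-1}]\subset\mathfrak b_{k-1}\}$. *)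

(* Defs.v *)
From HB Require Import structures.
From mathcomp Require Import all_boot all_order all_algebra.

Set Implicit Arguments.
Unset Strict Implicit.
Unset Printing Implicit Defensive.

Import GRing.Theory.
Local Open Scope ring_scope.

(* The underlying space of Lambda(n): f A is the coefficient in f of the
   monomial xi_A := xi_{a_1} ... xi_{a_r}, where A = {a_1 < ... < a_r}.
   Generators are numbered from 0. *)
Notation Grass K n := {ffun {set 'I_n} -> K^o}.

Section Grassmann.
Variables (K : fieldType) (n : nat).
Implicit Types (i : 'I_n) (A B C : {set 'I_n}) (f g : Grass K n).

Definition mono A : Grass K n := [ffun B => (B == A)%:R].
Definition xi i : Grass K n := mono [set i].

(* xi_A xi_B = (-1)^(ninv A B) xi_(A :|: B) when A and B are disjoint. *)
Definition ninv A B : nat :=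
  #|[set ab : 'I_n * 'I_n | [&& ab.1 \in A, ab.2 \in B & (ab.2 < ab.1)%N]]|.

Definition gmul f g : Grass K n :=
  [ffun C : {set 'I_n} =>
     \sum_(A : {set 'I_n} | A \subset C)
        (-1) ^+ ninv A (C :\: A) * (f A * g (C :\: A))].

(* The left derivative: del_i (xi_i xi_B) = xi_B and del_i xi_B = 0 when i is
   not in B; here xi_i xi_B = (-1)^(ninv [set i] B) xi_(i |: B). *)
Definition gdel i f : Grass K n :=
  [ffun B : {set 'I_n} =>
     if i \in B then 0 else (-1) ^+ ninv [set i] B * f (i |: B)].

(* f |-> (-1)^p(f) f, extended linearly to non-homogeneous f. *)
Definition gsign f : Grass K n := [ffun A : {set 'I_n} => (-1) ^+ #|A| * f A].

Definition gpart (b : bool) f : Grass K n :=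
  [ffun A : {set 'I_n} => if odd #|A| == b then f A else 0].

Fact gmul_is_linear f : linear (gmul f).
Proof.
move=> a g h; apply/ffunP=> C; rewrite !ffunE /= scaler_sumr -big_split /=.
apply: eq_bigr => A _; rewrite !ffunE /= [a *: g _]/(a * _) [a *: (_ * _)]/(a * _).
by rewrite mulrDr mulrDr !(mulrCA _ a).
Qed.
HB.instance Definition _ f :=
  GRing.isLinear.Build K (Grass K n) (Grass K n) _ (gmul f) (gmul_is_linear f).

Fact gdel_is_linear i : linear (gdel i).
Proof.
move=> a g h; apply/ffunP=> C; rewrite !ffunE /=; case: ifP => _.
  by rewrite scaler0 addr0.
by rewrite [a *: g _]/(a * _) [a *: (_ * _)]/(a * _) mulrDr mulrCA.
Qed.
HB.instance Definition _ i :=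
  GRing.isLinear.Build K (Grass K n) (Grass K n) _ (gdel i) (gdel_is_linear i).

Fact gsign_is_linear : linear gsign.
Proof.
move=> a g h; apply/ffunP=> C; rewrite !ffunE.
by rewrite [a *: g _]/(a * _) [a *: (_ * _)]/(a * _) mulrDr mulrCA.
Qed.
HB.instance Definition _ :=
  GRing.isLinear.Build K (Grass K n) (Grass K n) _ gsign gsign_is_linear.

Fact gpart_is_linear b : linear (gpart b).
Proof.
move=> a g h; apply/ffunP=> C; rewrite !ffunE; case: ifP => _ //.
by rewrite scaler0 addr0.
Qed.
HB.instance Definition _ b :=
  GRing.isLinear.Build K (Grass K n) (Grass K n) _ (gpart b) (gpart_is_linear b).

End Grassmann.
Arguments mono K {n} A.
Arguments xi K {n} i.

(* gl(Lambda(n)) with the supercommutator is the ambient Lie superalgebra; all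
   the others are subspaces of it, given as 'vspace's. *)
Notation gl K n := 'End(Grass K n).

Section LieSuperalgebras.
Variables (K : fieldType) (n : nat).
Implicit Types (D E : gl K n) (u v s t : {vspace gl K n}).

Definition hpart (b : bool) D : gl K n :=
  \sum_(c : bool)
     (linfun (@gpart K n (b (+) c)) \o D \o linfun (@gpart K n c))%VF.

(* [D, E] = D E - (-1)^(p(D) p(E)) E D for homogeneous D and E. *)
Definition sbracket D E : gl K n :=
  \sum_(a : bool) \sum_(b : bool)
     ((hpart a D \o hpart b E)%VF
        - (-1) ^+ (a && b) *: (hpart b E \o hpart a D)%VF).

Fact hpart_is_linear b : linear (hpart b).
Proof.
move=> a D E; rewrite /hpart scaler_sumr -big_split /=; apply: eq_bigr => c _.
by rewrite comp_lfunDr comp_lfunDl -comp_lfunZr -comp_lfunZl.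
Qed.
HB.instance Definition _ b :=
  GRing.isLinear.Build K (gl K n) (gl K n) _ (hpart b) (hpart_is_linear b).

Fact sbracketl_is_linear E : linear (sbracket^~ E).
Proof.
move=> a D1 D2; rewrite /sbracket scaler_sumr -big_split /=.
apply: eq_bigr => p _; rewrite scaler_sumr -big_split /=; apply: eq_bigr => q _.
rewrite linearP comp_lfunDl comp_lfunDr -comp_lfunZl -comp_lfunZr scalerBr.
by rewrite scalerDr !scalerA [_ * a]mulrC opprD addrACA.
Qed.

Fact sbracketr_is_linear D : linear (sbracket D).
Proof.
move=> a E1 E2; rewrite /sbracket scaler_sumr -big_split /=.
apply: eq_bigr => p _; rewrite scaler_sumr -big_split /=; apply: eq_bigr => q _.
rewrite linearP comp_lfunDr comp_lfunDl -comp_lfunZl -comp_lfunZr scalerBr.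
by rewrite scalerDr !scalerA [_ * a]mulrC opprD addrACA.
Qed.
HB.instance Definition _ D :=
  GRing.isLinear.Build K (gl K n) (gl K n) _ (sbracket D) (sbracketr_is_linear D).

Definition sbracketl E D : gl K n := sbracket D E.
HB.instance Definition _ E :=
  GRing.isLinear.Build K (gl K n) (gl K n) _ (sbracketl E) (sbracketl_is_linear E).

Definition brv u v : {vspace gl K n} :=
  <<[seq sbracket D E | D <- vbasis u, E <- vbasis v]>>%VS.

Lemma brvP u v s :
  (brv u v <= s)%VS <-> (forall D E, D \in u -> E \in v -> sbracket D E \in s).
Proof.
split=> [sub_s D E uD vE | brs]; last first.
  by apply/span_subvP=> _ /allpairsP[[D E] [/vbasis_mem uD /vbasis_mem vE ->]]; apply: brs.
apply: (subvP sub_s); rewrite (coord_vbasis uD) (coord_vbasis vE).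
rewrite -/(sbracketl _ _) linear_sum memv_suml // => i _; rewrite linearZ memvZ //=.
rewrite /sbracketl linear_sum memv_suml // => j _; rewrite linearZ memvZ //=.
by apply/memv_span/allpairs_f; rewrite memt_nth.
Qed.

Definition subsuperalgebra s : Prop :=
  (forall b D, D \in s -> hpart b D \in s) /\ (brv s s <= s)%VS.

Definition lie_solvable s : Prop := exists m, iter m (fun u => brv u u) s = 0%VS.

Section Graded.
Variables (I : Type) (gr : I -> {vspace gl K n}).

Definition graded s : Prop :=
  exists2 r : seq I, directv (\sum_(i <- r) (s :&: gr i))
                   & s = (\sum_(i <- r) (s :&: gr i))%VS.

Definition maximal_solvable (g s : {vspace gl K n}) : Prop :=
  [/\ (s <= g)%VS, subsuperalgebra s, graded s & lie_solvable s] /\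
  (forall t, (t <= g)%VS -> subsuperalgebra t -> graded t -> lie_solvable t ->
     (s <= t)%VS -> s = t).

End Graded.

(* Subspaces of the degree 0 component, which is purely even in the cases below,
   are automatically graded and parity-homogeneous. *)
Definition maximal_solvable_subalgebra (g0 s : {vspace gl K n}) : Prop :=
  [/\ (s <= g0)%VS, (brv s s <= s)%VS & lie_solvable s] /\
  (forall t, (t <= g0)%VS -> (brv t t <= t)%VS -> lie_solvable t ->
     (s <= t)%VS -> s = t).

Section Prolong.
Variables (gr : int -> {vspace gl K n}) (bm1 b0 : {vspace gl K n}).

Fixpoint prolong_comp (k : nat) : {vspace gl K n} :=
  if k is k'.+1 then
    (gr k%:Z :&:
       \bigcap_(E <- vbasis bm1) (linfun (sbracketl E) @^-1: prolong_comp k'))%VS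
  else b0.

Lemma memv_prolong_comp k D :
  D \in prolong_comp k.+1 <->
  D \in gr k.+1%:Z /\ (forall E, E \in bm1 -> sbracket D E \in prolong_comp k).
Proof.
have mem_cap (T : seq (gl K n)) :
  (D \in (\bigcap_(E <- T) (linfun (sbracketl E) @^-1: prolong_comp k))%VS)
    = all (fun E => sbracket D E \in prolong_comp k) T.
  elim: T => [|E T IH]; first by rewrite big_nil memvf.
  by rewrite big_cons memv_cap IH -memv_preim lfunE.
rewrite /= memv_cap mem_cap; split=> [/andP[-> /allP brD]|[-> brD]]; last first.
  by apply/allP=> E /vbasis_mem /brD.
split=> // E /coord_vbasis->; rewrite linear_sum memv_suml // => i _.
by rewrite linearZ memvZ //= brD // memt_nth.
Qed.

(* For the gradings below gr k = 0 when k >= n, so this is the sum over all k. *)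
Definition prolong : {vspace gl K n} := (bm1 + \sum_(k < n) prolong_comp k)%VS.

End Prolong.

End LieSuperalgebras.

Section VectorFields.
Variables (K : fieldType) (n : nat).
Implicit Types (A : {set 'I_n}) (D : gl K n) (f : Grass K n).

Definition lmul f : gl K n := linfun (gmul f).
Definition del (i : 'I_n) : gl K n := linfun (@gdel K n i).

Definition vect : {vspace gl K n} :=
  (\sum_(A : {set 'I_n}) \sum_(i < n) <[(lmul (mono K A) \o del i)%VF]>)%VS.

Definition vect_ (d : int) : {vspace gl K n} :=
  (\sum_(A : {set 'I_n} | #|A|%:Z - 1 == d)
     \sum_(i < n) <[(lmul (mono K A) \o del i)%VF]>)%VS.

(* If D = sum_i f_i del_i then f_i = D xi_i. *)
Definition Div D : Grass K n := \sum_(i < n) del i (gsign (D (xi K i))).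

Fact Div_is_linear : linear Div.
Proof.
move=> a D E; rewrite /Div scaler_sumr -big_split /=; apply: eq_bigr => i _.
by rewrite add_lfunE scale_lfunE !linearP.
Qed.
HB.instance Definition _ :=
  GRing.isLinear.Build K (gl K n) (Grass K n) _ Div Div_is_linear.

Definition svect : {vspace gl K n} := (vect :&: lker (linfun Div))%VS.
Definition svect_ (d : int) : {vspace gl K n} := (svect :&: vect_ d)%VS.

End VectorFields.

Section Hamiltonian.
Variables (K : fieldType) (k l : nat).
Local Notation n := (k + k + l)%N.

Definition ixi (i : 'I_k) : 'I_n := lshift l (lshift k i).
Definition ieta (i : 'I_k) : 'I_n := lshift l (rshift k i).
Definition izeta (j : 'I_l) : 'I_n := rshift (k + k) j.

(* H_f, extended linearly to non-homogeneous f: (-1)^p(f) is absorbed in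
   gsign f. *)
Definition ham (f : Grass K n) : gl K n :=
  \sum_(i < k)
     ((lmul (del K (ixi i) (gsign f)) \o del K (ieta i))%VF
      + (lmul (del K (ieta i) (gsign f)) \o del K (ixi i))%VF)
  + \sum_(j < l) (lmul (del K (izeta j) (gsign f)) \o del K (izeta j))%VF.

Definition ham_alg : {vspace gl K n} :=
  (\sum_(A : {set 'I_n}) <[ham (mono K A)]>)%VS.

(* The constant A = set0, of degree -2, contributes 0. *)
Definition ham_alg_ (d : int) : {vspace gl K n} :=
  (\sum_(A : {set 'I_n} | #|A|%:Z - 2 == d) <[ham (mono K A)]>)%VS.

End Hamiltonian.

Section DeformedSvect.
Variables (K : fieldType) (n : nat).
Local Notation m := (2 * n)%N.

(* 1 + Xi, with Xi = xi_1 ... xi_{2n}. *)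
Definition oneXi : Grass K m := mono K set0 + mono K setT.

Definition tsvect : {vspace gl K m} :=
  <<[seq (lmul oneXi \o D)%VF | D <- vbasis (svect K m)]>>%VS.

(* Degrees modulo 2n; the class of -1 is 2n - 1, and the other classes are
   represented by their values 0, ..., 2n - 2. *)
Definition tsvect_ (d : 'Z_m) : {vspace gl K m} :=
  if d == -1 then (\sum_(i < m) <[(lmul oneXi \o del K i)%VF]>)%VS
  else svect_ K m (d : nat)%:Z.

End DeformedSvect.

(* Main.v *)
From HB Require Import structures.
Require Import Defs.
From mathcomp Require Import all_boot all_order all_algebra.
From mathcomp Require Import ring zify.

(** The first three assertions are one fact about a subalgebra g of vect(0|n)
    whose components gr d consist of vector fields of degree d
    ([prolong_maximal_solvable], [vector_field_prolong]). Let s be the prolong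
    of g_{-1} and s_0.

    Maximality of s is formal. If t is graded, solvable and contains s, then
    t_0 is a solvable subalgebra of g_0 containing s_0, so t_0 = s_0; and since
    [t_k, g_{-1}] lies in t_{k-1}, induction on k puts t_k in the prolong.
    Likewise s is closed under the bracket: membership in the prolong is tested
    by bracketing with g_{-1}, so the super Jacobi identity reduces the claim
    for [s_k, s_l] to a smaller total degree.

    The point is that s is solvable although it contains all of g_{-1}. Over an
    algebraically closed field of characteristic 0 a Lie superalgebra is
    solvable as soon as its even part is ([superalgebra_solvable], due to Kac).
    Indeed it is enough to exclude a perfect p = [p, p] with solvable even part
    p_0 and nonzero odd part p_1. Lie's theorem ([lie_common_eigenvector]),
    applied to p_0 acting on the dual of p_1, gives a nonzero functional f and a
    weight lam with f [x, y] = lam(y) f(x) for x odd and y even. The Jacobi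
    identity for three odd elements reads
      lam [u, v] f(w) + lam [v, w] f(u) + lam [u, w] f(v) = 0,
    which forces lam = 0 on [p_1, p_1]; as lam also vanishes on [p_0, p_0], it
    vanishes on p_0, whence f = 0 on [p_0, p_1] = p_1, a contradiction. In the
    case at hand the even part of s lies in s_0 plus components of positive
    degree, and the derived series pushes the latter into ever higher degrees
    ([solvable_add_degree_ge1]).

    What is left for each series is that the bracket adds degrees. For vect,
    the component of degree d is exactly the space of superderivations of
    degree d ([vect_P]), and superderivations are stable under the
    supercommutator. For svect the chain rule shows that vanishing divergence
    is preserved ([divergence_sbracket]); for h(0|n) it gives
    [H_f, H_g] = H_(H_f g) ([sbracket_ham]).

    In the deformed algebra the subspace of degree -1 alone already generates
    something unsolvable. With T_i = (1 + Xi) del_i one has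
    [T_i, T_i] = 2 (del_i Xi) del_i ([sbracket_T]), and bracketing with T_c
    removes the factor xi_c from the coefficient of such a field
    ([sbracket_T_lower]). Removing one factor after another leaves all the
    fields xi_i del_j with i and j distinct, hence a copy of sl(2)
    ([not_solvable_sl2]). *)

Set Implicit Arguments.
Unset Strict Implicit.
Unset Printing Implicit Defensive.

Import Order.TTheory GRing.Theory Num.Theory.
Local Open Scope ring_scope.

(** * Maps known to be linear *)

(** The bracket of an abstract Lie superalgebra below is an arbitrary function
    with a proof of bilinearity, so linearity has to be usable from a
    hypothesis rather than from a declared structure. *)
Section Lin.
Variables (K : fieldType) (U V : lmodType K) (f : U -> V).
Hypothesis lf : linear f.

Definition linear_of : {linear U -> V} :=
  HB.pack f (GRing.isLinear.Build K U V _ f lf).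

Lemma lin0 : f 0 = 0. Proof. exact: (linear0 linear_of). Qed.
Lemma linD x y : f (x + y) = f x + f y. Proof. exact: (linearD linear_of). Qed.
Lemma linN x : f (- x) = - f x. Proof. exact: (linearN linear_of). Qed.
Lemma linB x y : f (x - y) = f x - f y. Proof. exact: (linearB linear_of). Qed.
Lemma linZ a x : f (a *: x) = a *: f x. Proof. exact: (linearZ_LR linear_of). Qed.
Lemma lin_sum I (r : seq I) P (F : I -> U) :
  f (\sum_(i <- r | P i) F i) = \sum_(i <- r | P i) f (F i).
Proof. exact: (linear_sum linear_of). Qed.
End Lin.

Lemma linfunE (K : fieldType) (U V : vectType K) (f : U -> V) (lf : linear f) :
  linfun (linear_of lf) =1 f.
Proof. exact: lfunE. Qed.

(** * Lie's theorem on common eigenvectors *)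

Lemma stable_eigenvector (K : numClosedFieldType) (V : vectType K)
    (f : 'End(V)) (W : {vspace V}) :
  W != 0%VS -> (forall w, w \in W -> f w \in W) ->
  exists w a, [/\ w \in W, w != 0 & f w = a *: w].
Proof.
rewrite -dimv_eq0 -lt0n => W_gt0 fW.
pose A := \matrix_(i < \dim W, j < \dim W) coord (vbasis W) j (f (vbasis W)`_i).
have [a /eigenvalueP[v vA nz_v]] := eigenvalue_closed A W_gt0.
exists (\sum_i v 0 i *: (vbasis W)`_i), a; split.
- by apply: memv_suml => i _; apply/memvZ/vbasis_mem/mem_nth; rewrite size_tuple.
- apply: contraNneq nz_v => v0'; have /freeP/(_ _ v0') v0 := basis_free (vbasisP W).
  by apply/eqP/rowP=> i; rewrite v0 mxE.
transitivity (\sum_j (v *m A) 0 j *: (vbasis W)`_j); last first.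
  by rewrite vA scaler_sumr; apply: eq_bigr => j _; rewrite mxE scalerA.
rewrite linear_sum (eq_bigr (fun i => \sum_j (v 0 i * A i j) *: (vbasis W)`_j)).
  rewrite exchange_big; apply: eq_bigr => j _ /=.
  by rewrite mxE scaler_suml.
move=> i _; rewrite linearZ /= [in LHS](coord_vbasis (fW _ _)).
  by rewrite scaler_sumr; apply: eq_bigr => j _; rewrite mxE scalerA.
by apply/vbasis_mem/mem_nth; rewrite size_tuple.
Qed.

Lemma coord_line (K : fieldType) (V : vectType K) (w : V) a :
  w != 0 -> coord [tuple w] ord0 (a *: w) = a.
Proof.
move=> nz_w; have fr : free [tuple w] by rewrite seq1_free.
have e1 : coord [tuple w] ord0 w = 1 := coord_free ord0 ord0 fr.
by rewrite linearZ /= e1; apply: mulr1.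
Qed.

(** Solvability as a chain of ideals, each of codimension at most one in the
    next: the form on which Lie's theorem is proved by induction. *)
Inductive polycyclic (K : fieldType) (T : vectType K) (br : T -> T -> T) :
  {vspace T} -> Prop :=
| Polycyclic0 : polycyclic br 0%VS
| PolycyclicS H X : polycyclic br H ->
    (forall A B, A \in (H + <[X]>)%VS -> B \in (H + <[X]>)%VS -> br A B \in H) ->
    polycyclic br (H + <[X]>)%VS.

Section Lie.
Variables (K : numClosedFieldType) (T V : vectType K) (br : T -> T -> T).
Implicit Types (A B X : T) (H L : {vspace T}) (W : {vspace V}).

Variable rho : {linear T -> 'End(V)}.

Definition representation L W : Prop :=
  (forall A w, A \in L -> w \in W -> rho A w \in W) /\
  (forall A B w, A \in L -> B \in L -> w \in W ->
     rho (br A B) w = rho A (rho B w) - rho B (rho A w)).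

(** The inductive step of Lie's theorem. Here e i is the image of a weight
    vector e 0 of the ideal H under the i-th power of X; the point is that H
    acts on the span of the e i triangularly, with the constant diagonal lam. *)
Section Krylov.
Variables (H : {vspace T}) (X : T) (lam : T -> K) (e : nat -> V).
Hypotheses (brHX : forall A, A \in H -> br A X \in H) (nz_e0 : e 0%N != 0).
Hypothesis eS : forall i, rho X (e i) = e i.+1.
Hypothesis rho_br : forall A i, A \in H ->
  rho A (e i.+1) = rho X (rho A (e i)) + rho (br A X) (e i).
Hypothesis lam_e0 : forall A, A \in H -> rho A (e 0%N) = lam A *: e 0%N.

Fixpoint krylov i : {vspace V} :=
  if i is j.+1 then (krylov j + <[e j]>)%VS else 0%VS.

Lemma krylovS i : (krylov i <= krylov i.+1)%VS.
Proof. exact: addvSl. Qed.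

Lemma krylov_last i : e i \in krylov i.+1.
Proof. by apply: subvP (memv_line _); apply: addvSr. Qed.

Lemma krylov_shift i u : u \in krylov i -> rho X u \in krylov i.+1.
Proof.
elim: i u => [|i IHi] u; first by rewrite memv0 => /eqP->; rewrite linear0 mem0v.
case/memv_addP=> u1 u1K [_ /vlineP[c ->] ->].
rewrite linearD linearZ rpredD //.
  by apply: subvP (krylovS _) _ (IHi _ u1K).
by rewrite memvZ //= eS; apply: (krylov_last i.+1).
Qed.

(** The coefficient i + 1 counts the ways to move A past one of the i + 1 copies
    of X in e (i + 1). Keeping track of it, and not only of the diagonal, makes
    it possible to conclude without traces. *)
Lemma krylov_weight i A : A \in H ->
  rho A (e i.+1) - lam A *: e i.+1 - (i.+1%:R * lam (br A X)) *: e i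
    \in krylov i
  /\ rho A (e i) - lam A *: e i \in krylov i.
Proof.
elim: i A => [|i IHi] A HA.
  rewrite rho_br // (lam_e0 HA) (lam_e0 (brHX HA)) linearZ /= eS mul1r addrAC addrK.
  by rewrite !subrr !mem0v.
have HB := brHX HA.
have weak B : B \in H -> rho B (e i.+1) - lam B *: e i.+1 \in krylov i.+1.
  move=> /IHi[/(subvP (krylovS _)) mem _].
  rewrite -[X in X \in _](subrK ((i.+1%:R * lam (br B X)) *: e i)).
  by rewrite rpredD // memvZ ?krylov_last.
split; last exact: weak.
have [/krylov_shift memA _] := IHi _ HA.
rewrite rho_br //.
have -> : rho X (rho A (e i.+1)) + rho (br A X) (e i.+1) - lam A *: e i.+2
    - (i.+2%:R * lam (br A X)) *: e i.+1 =
  rho X (rho A (e i.+1) - lam A *: e i.+1 - (i.+1%:R * lam (br A X)) *: e i)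
  + (rho (br A X) (e i.+1) - lam (br A X) *: e i.+1).
  rewrite !linearB !linearZ /= !eS [RHS]addrACA -scalerDl -[i.+2]addn1 natrD.
  by rewrite mulrDl mul1r [X in _ = X + _]addrAC.
by rewrite rpredD // weak.
Qed.

(** The spans cannot grow for ever; taking the first index at which the growth
    stops also keeps e i out of the previous span. *)
Lemma krylov_full : exists2 i, e i \notin krylov i & e i.+1 \in krylov i.+1.
Proof.
have [/forallP all_notin|] :=
    boolP [forall i : 'I_(dim V).+1, e i \notin krylov i].
  have dimK j : (j <= (dim V).+1)%N -> (j <= \dim (krylov j))%N.
    elim: j => // j IHj lt_j; apply: leq_ltn_trans (IHj (ltnW lt_j)) _.
    rewrite ltn_neqAle (dimv_leqif_eq (krylovS j)) dimvS ?krylovS // andbT.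
    apply: contraNneq (all_notin (Ordinal lt_j)) => /= ->.
    exact: (krylov_last j).
  have := leq_trans (dimK _ (leqnn _)) (dimvS (subvf _)).
  by rewrite dimvf ltnn.
rewrite negb_forall => /existsP[i]; rewrite negbK; move: (nat_of_ord i) => {}i.
elim: i => [|i IHi] mem; first by rewrite /= memv0 (negPf nz_e0) in mem.
by have [/IHi|nmem] := boolP (e i \in krylov i); last exists i.
Qed.

(** At the index i where the spans stop growing, e (i + 1) is a combination of
    e 0, ..., e i, so A - lam A maps it into the span of e 0, ..., e (i - 1).
    Comparing with [krylov_weight] leaves (i + 1) lam (br A X) = 0, and the
    characteristic is 0. *)
Lemma weight_bracket_eq0 A : A \in H -> lam (br A X) = 0.
Proof.
move=> HA; have [i nmem /memv_addP[u uK [_ /vlineP[c ->] def_e]]] := krylov_full.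
have [mem _] := krylov_weight i HA.
have stab j v : v \in krylov j -> rho A v - lam A *: v \in krylov j.
  elim: j v => [|j IHj] v.
    by rewrite memv0 => /eqP->; rewrite linear0 scaler0 subrr mem0v.
  case/memv_addP=> v1 v1K [_ /vlineP[d ->] ->].
  rewrite linearD scalerDr opprD addrACA rpredD //.
    by apply: subvP (krylovS _) _ _; apply: IHj.
  rewrite linearZ scalerA mulrC -scalerA -scalerBr memvZ //.
  by apply: subvP (krylovS _) _ _; have [] := krylov_weight j HA.
have mem1 : rho A (e i.+1) - lam A *: e i.+1 \in krylov i.
  rewrite def_e linearD scalerDr opprD addrACA rpredD ?(stab _ u) //.
  rewrite linearZ scalerA mulrC -scalerA -scalerBr memvZ //.
  by have [] := krylov_weight i HA.
have: (i.+1%:R * lam (br A X)) *: e i \in krylov i.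
  by have := rpredB mem1 mem; rewrite subKr.
apply: contraTeq => nz; rewrite rpredZeq negb_or nmem mulf_neq0 //.
by rewrite pnatr_eq0.
Qed.

End Krylov.

(** Induction on the chain of ideals: the weight space of H for the weight of an
    H-eigenvector is stable under X because lam vanishes on brackets with X, so
    it contains an eigenvector of X. *)
Theorem lie_common_eigenvector L W : polycyclic br L -> representation L W ->
  W != 0%VS ->
  exists w, [/\ w \in W, w != 0 &
    exists lam : T -> K, forall A, A \in L -> rho A w = lam A *: w].
Proof.
move=> pL; elim: pL W => {L} [|H X _ IH brHX] W [stabW repW] nzW.
  exists (vpick W); rewrite memv_pick vpick0; split=> //.
  by exists (fun=> 0) => A; rewrite memv0 => /eqP->; rewrite linear0 zero_lfunE scale0r.
have sHL : (H <= H + <[X]>)%VS := addvSl _ _.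
have inHL A : A \in H -> A \in (H + <[X]>)%VS by apply: subvP.
have XL : X \in (H + <[X]>)%VS by apply: subvP (addvSr _ _) _ (memv_line _).
have brH A : A \in H -> br A X \in H by move=> /inHL HA; apply: brHX.
have [|w0 [w0W nz_w0 [lam0 lam0P]]] := IH W _ nzW.
  by split=> [A w /inHL | A B w /inHL AL /inHL]; [apply: stabW | apply: repW].
pose lam A := coord [tuple w0] ord0 (rho A w0).
have lamP A : A \in H -> rho A w0 = lam A *: w0.
  by move=> HA; rewrite /lam lam0P // coord_line.
(* The weight space of lam in W. *)
pose W' := (W :&: \bigcap_(A <- vbasis H) lker (rho A - lam A *: \1%VF))%VS.
have memW' w : (w \in W') <-> (w \in W /\ forall A, A \in H -> rho A w = lam A *: w).
  have mem_cap (s : seq T) : (w \in \bigcap_(A <- s) lker (rho A - lam A *: \1%VF))%VS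
      = all (fun A => rho A w == lam A *: w) s.
    elim: s => [|A s IHs]; first by rewrite big_nil memvf.
    rewrite big_cons memv_cap IHs memv_ker add_lfunE opp_lfunE scale_lfunE id_lfunE.
    by rewrite subr_eq0.
  rewrite memv_cap mem_cap; split=> [/andP[-> /allP ew]|[-> ew]]; last first.
    by apply/allP=> A /vbasis_mem/ew->.
  split=> // A /coord_vbasis->.
  rewrite /lam !(linear_sum, sum_lfunE) /= scaler_suml.
  apply: eq_bigr => i _; rewrite !linearZ !scale_lfunE !linearZ /= -scalerA.
  by congr (_ *: _); apply/eqP/ew/mem_nth; rewrite size_tuple.
have W'w0 : w0 \in W' by apply/memW'.
have nzW' : W' != 0%VS by apply: contraNneq nz_w0 => W'0; rewrite -memv0 -W'0.
have stabX w : w \in W' -> rho X w \in W'.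
  case/memW'=> wW ew; apply/memW'; split=> [|A HA]; first exact: stabW.
  have [->|nz_w] := eqVneq w 0; first by rewrite !linear0.
  have iterW i : iter i (rho X) w \in W.
    by elim: i => //= i; apply: stabW.
  have rho_br B i : B \in H ->
     rho B (iter i.+1 (rho X) w) =
       rho X (rho B (iter i (rho X) w)) + rho (br B X) (iter i (rho X) w).
    by move=> /inHL HB; rewrite (repW _ _ _ HB XL (iterW i)) addrC subrK.
  rewrite (rho_br A 0%N HA) /= (ew A HA) (ew _ (brH _ HA)) linearZ /=.
  by rewrite (weight_bracket_eq0 (e := fun i => iter i (rho X) w) brH) ?scale0r ?addr0.
have [w [a [/memW'[wW ew] nz_w eX]]] := stable_eigenvector nzW' stabX.
exists w; split=> //.
exists (fun A => coord [tuple w] ord0 (rho A w)) => _ /memv_addP[A HA [_ /vlineP[c ->] ->]].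
rewrite linearD linearZ add_lfunE scale_lfunE ew // eX scalerA -scalerDl.
by rewrite coord_line.
Qed.

End Lie.

(** * Solvability for an abstract super bracket *)

(** The axioms of a Lie superalgebra on T, with hp b the projection onto the
    part of parity b. *)
Record super_bracket (K : fieldType) (T : vectType K)
    (br : T -> T -> T) (hp : bool -> T -> T) : Prop := SuperBracket {
  br_linl : forall y, linear (br^~ y);
  br_linr : forall x, linear (br x);
  hp_lin : forall b, linear (hp b);
  hp_hp : forall b c x, hp b (hp c x) = if b == c then hp b x else 0;
  hp_sum : forall x, hp true x + hp false x = x;
  br_hp : forall a b x y, hp a x = x -> hp b y = y -> hp (a (+) b) (br x y) = br x y;
  br_antisym : forall a b x y, hp a x = x -> hp b y = y ->
    br x y = - ((-1) ^+ (a && b) *: br y x);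
  br_jacobi : forall a b c x y z, hp a x = x -> hp b y = y -> hp c z = z ->
    br (br x y) z = br x (br y z) + (-1) ^+ (b && c) *: br (br x z) y }.

Section Derived.
Variables (K : fieldType) (T : vectType K) (br : T -> T -> T).
Hypothesis (br_linl : forall y, linear (br^~ y)) (br_linr : forall x, linear (br x)).
Implicit Types (x y z : T) (s t u v : {vspace T}).

Definition bracket_span u v : {vspace T} :=
  <<[seq br x y | x <- vbasis u, y <- vbasis v]>>%VS.

Definition solvable u : Prop :=
  exists m, iter m (fun u => bracket_span u u) u = 0%VS.

Lemma bracket_spanP u v s :
  (bracket_span u v <= s)%VS <-> (forall x y, x \in u -> y \in v -> br x y \in s).
Proof.
split=> [sub_s x y ux vy | brs]; last first.
  by apply/span_subvP=> _ /allpairsP[[x y] [/vbasis_mem ux /vbasis_mem vy ->]]; apply: brs.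
apply: (subvP sub_s); rewrite (coord_vbasis ux) (coord_vbasis vy).
rewrite (lin_sum (br_linl _)) memv_suml // => i _; rewrite (linZ (br_linl _)) memvZ //.
rewrite (lin_sum (br_linr _)) memv_suml // => j _; rewrite (linZ (br_linr _)) memvZ //.
by apply/memv_span/allpairs_f; rewrite memt_nth.
Qed.

Lemma memv_bracket u v x y : x \in u -> y \in v -> br x y \in bracket_span u v.
Proof. by have [brs _] := bracket_spanP u v (bracket_span u v); apply: brs. Qed.

Lemma bracket_spanS u1 u2 v1 v2 : (u1 <= u2)%VS -> (v1 <= v2)%VS ->
  (bracket_span u1 v1 <= bracket_span u2 v2)%VS.
Proof.
by move=> /subvP su /subvP sv; apply/bracket_spanP=> x y /su ux /sv; apply: memv_bracket.
Qed.

Lemma solvableS u v : (u <= v)%VS -> solvable v -> solvable u.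
Proof.
move=> suv [m v0]; exists m; apply/eqP; rewrite -subv0 -v0.
by elim: m {v0} => //= m IHm; apply: bracket_spanS.
Qed.

Lemma solvable_derived u : solvable (bracket_span u u) -> solvable u.
Proof. by case=> m u0; exists m.+1; rewrite iterSr. Qed.

Lemma solvable_perfect u : solvable u -> bracket_span u u = u -> u = 0%VS.
Proof.
by case=> m u0 uu; rewrite -u0; elim: m {u0} => //= m <-; rewrite uu.
Qed.

(** Adjoining one vector at a time to v, the last step before u is reached. *)
Lemma hyperplane_above u v : (v <= u)%VS -> v != u ->
  exists H x, [/\ (v <= H)%VS, H != u & u = (H + <[x]>)%VS].
Proof.
have [m] := ubnP (\dim u - \dim v)%N; elim: m v => // m IHm v le_m svu nvu.
have /subvPn[x ux nvx] : ~~ (u <= v)%VS.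
  by apply: contra nvu => suv; rewrite eqEsubv svu.
have svx : (v + <[x]> <= u)%VS by rewrite subv_add svu -memvE.
have [evx|nvx'] := eqVneq (v + <[x]>)%VS u; first by exists v, x.
have lt_dim : (\dim v < \dim (v + <[x]>))%N.
  rewrite ltn_neqAle (dimv_leqif_eq (addvSl _ _)) dimvS ?addvSl // andbT.
  by apply: contraNneq nvx => ->; apply: subvP (addvSr _ _) _ (memv_line _).
have [|H [y [sH nH def_u]]] := IHm _ _ svx nvx'.
  by have := dimvS svx; move: le_m lt_dim; lia.
by exists H, y; split=> //; apply: subv_trans sH; apply: addvSl.
Qed.

(** Any hyperplane of u containing the derived algebra is an ideal, and it is
    proper because a solvable algebra that equals its derived algebra is 0. *)
Lemma solvable_polycyclic u : (bracket_span u u <= u)%VS -> solvable u ->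
  polycyclic br u.
Proof.
have [m] := ubnP (\dim u); elim: m u => // m IHm u le_m suu sol_u.
have [->|nz_u] := eqVneq u 0%VS; first exact: Polycyclic0.
have [|H [x [sH nH def_u]]] := hyperplane_above suu.
  by apply: contraNneq nz_u => /(solvable_perfect sol_u)->.
have sHu : (H <= u)%VS by rewrite def_u addvSl.
rewrite def_u; apply: PolycyclicS => [|y z].
  apply: IHm.
  - apply: leq_trans (le_m : (\dim u <= m)%N).
    by rewrite ltn_neqAle (dimv_leqif_eq sHu) nH dimvS.
  - by apply: subv_trans (bracket_spanS sHu sHu) sH.
  exact: solvableS sHu sol_u.
by rewrite -def_u => uy uz; apply: subvP sH _ (memv_bracket uy uz).
Qed.

End Derived.

Section Coadjoint.
Variables (K : fieldType) (T : vectType K) (br : T -> T -> T).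
Hypothesis (br_linl : forall y, linear (br^~ y)) (br_linr : forall x, linear (br x)).
Variable s : {vspace T}.
Local Notation dual := 'Hom(subvs_of s, K^o).

Definition precomp (g : 'End(subvs_of s)) (phi : dual) : dual := (phi \o g)%VF.
Fact precomp_is_linear g : linear (precomp g).
Proof. by move=> a p q; rewrite /precomp comp_lfunDl comp_lfunZl. Qed.

(** y acts on functionals on s by phi |-> phi (br _ y). The element y stands on
    the right of the bracket, which absorbs the sign of the contragredient
    action; vsproj makes the formula meaningful for every y, and on y that
    normalise s it is the coadjoint action. *)
Definition coad_fun (y : T) : 'End(dual) :=
  linfun (linear_of (precomp_is_linear
    (linfun (vsproj s) \o linfun (linear_of (br_linl y)) \o linfun vsval)%VF)).

Lemma coad_funE y phi x : coad_fun y phi x = phi (vsproj s (br (vsval x) y)).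
Proof.
rewrite /coad_fun linfunE /precomp !comp_lfunE (lfunE (vsproj s)).
by rewrite (linfunE (br_linl y)) lfunE.
Qed.

Fact coad_is_linear : linear coad_fun.
Proof.
move=> a y z; apply/lfunP=> phi; apply/lfunP=> x.
rewrite add_lfunE scale_lfunE !(add_lfunE, scale_lfunE, coad_funE).
by rewrite (linD (br_linr _)) (linZ (br_linr _)) !linearP.
Qed.

Definition coad : {linear T -> 'End(dual)} := linear_of coad_is_linear.

End Coadjoint.

(** * A Lie superalgebra is solvable as soon as its even part is *)

Section Kac.
Variables (K : numClosedFieldType) (T : vectType K).
Variables (br : T -> T -> T) (hp : bool -> T -> T).
Hypothesis sb : super_bracket br hp.
Implicit Types (x y z u v w : T) (s : {vspace T}).
Let brl := br_linl sb.
Let brr := br_linr sb.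
Let hl := hp_lin sb.

Definition parity_part b s : {vspace T} :=
  (s :&: fixedSpace (linfun (linear_of (hl b))))%VS.

Lemma parity_partP b s x :
  reflect (x \in s /\ hp b x = x) (x \in parity_part b s).
Proof.
rewrite memv_cap; apply: (iffP andP) => [[-> /fixedSpaceP]|[-> hx]].
  by rewrite linfunE.
by split=> //; apply/fixedSpaceP; rewrite linfunE.
Qed.

Lemma hp_id b c x : hp c x = x -> hp b x = if b == c then x else 0.
Proof. by move=> hx; rewrite -hx (hp_hp sb); case: eqP => [->|]; rewrite ?hx. Qed.

Definition sub_superalgebra s :=
  (forall b x, x \in s -> hp b x \in s) /\ (bracket_span br s s <= s)%VS.

Lemma sub_superalgebra_derived s :
  sub_superalgebra s -> sub_superalgebra (bracket_span br s s).
Proof.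
case=> hs brs; split=> [b|]; last exact: bracket_spanS.
have: (bracket_span br s s <=
       linfun (linear_of (hl b)) @^-1: bracket_span br s s)%VS.
  apply/(bracket_spanP brl brr) => x y sx sy; rewrite -memv_preim linfunE.
  rewrite -(hp_sum sb x) -(hp_sum sb y) !(linD (brl _)) !(linD (brr _)) !(linD (hl _)).
  have hb c d : hp b (br (hp c x) (hp d y)) \in bracket_span br s s.
    have hc : hp c (hp c x) = hp c x by rewrite (hp_hp sb) eqxx.
    have hd : hp d (hp d y) = hp d y by rewrite (hp_hp sb) eqxx.
    rewrite (hp_id b (br_hp sb hc hd)).
    by case: ifP => _; rewrite ?mem0v // memv_bracket ?hs.
  by rewrite !rpredD.
by move=> /subvP sub x /sub; rewrite -memv_preim linfunE.
Qed.

(** Lie's theorem for the even part acting on the dual of the odd part. A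
    functional is wanted rather than an eigenvector, so that the Jacobi identity
    for odd elements becomes a relation between scalars. *)
Lemma odd_weight_functional s : sub_superalgebra s ->
  solvable br (parity_part false s) -> parity_part true s != 0%VS ->
  exists (f : {linear T -> K^o}) (lam : T -> K),
    (exists2 x, x \in parity_part true s & f x != 0) /\
    (forall x y, x \in parity_part true s -> y \in parity_part false s ->
       f (br x y) = lam y * f x).
Proof.
case=> hs /(bracket_spanP brl brr) brs sol nz_s1.
set s0 := parity_part false s in sol *; set s1 := parity_part true s in nz_s1 *.
have brs0 : (bracket_span br s0 s0 <= s0)%VS.
  apply/(bracket_spanP brl brr)=> x y /parity_partP[sx hx] /parity_partP[sy hy].
  by apply/parity_partP; rewrite brs // (br_hp sb hx hy).
have brs1 x y : x \in s1 -> y \in s0 -> br x y \in s1.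
  move=> /parity_partP[sx hx] /parity_partP[sy hy].
  by apply/parity_partP; rewrite brs // (br_hp sb hx hy).
have repW : representation br (coad brl brr s1) s0 fullv.
  split=> [*|y z phi sy sz _]; first exact: memvf.
  apply/lfunP=> x; rewrite add_lfunE opp_lfunE !coad_funE.
  have sx : vsval x \in s1 := subvsP x.
  rewrite !vsprojK ?brs1 // -linearB -linearB /=; congr (phi (vsproj _ _)).
  move: sx sy sz => /parity_partP[_ hx] /parity_partP[_ hy] /parity_partP[_ hz].
  by rewrite (br_jacobi sb hx hy hz) scale1r addrK.
have nzW : fullv != 0%VS :> {vspace 'Hom(subvs_of s1, K^o)}.
  rewrite -dimv_eq0 in nz_s1; rewrite -lt0n in nz_s1.
  pose i0 := Ordinal nz_s1.
  have lin_phi : linear (fun x : subvs_of s1 => coord (vbasis s1) i0 (vsval x) : K^o).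
    by move=> a u v; rewrite !linearP.
  apply: contraTneq (memvf (linfun (linear_of lin_phi))) => ->; rewrite memv0.
  apply/lfunPn; exists (vsproj s1 (vbasis s1)`_i0).
  rewrite zero_lfunE linfunE vsprojK; last first.
    by apply/vbasis_mem/mem_nth; rewrite size_tuple.
  have fr := basis_free (vbasisP s1).
  by rewrite (coord_free i0 i0 fr) eqxx oner_neq0.
have [phi [_ nz_phi [lam lamP]]] :=
  lie_common_eigenvector (solvable_polycyclic brl brr brs0 sol) repW nzW.
exists (phi \o vsproj s1), lam; split.
  have /lfunPn[x] := nz_phi; rewrite zero_lfunE => nz_x.
  by exists (vsval x); rewrite ?subvsP //= vsvalK.
move=> x y sx sy /=.
have := congr1 (fun p : 'Hom(_, _) => p (vsproj s1 x)) (lamP y sy).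
by rewrite /= coad_funE scale_lfunE vsprojK.
Qed.

(** With g u v = lam (br u v) for odd u and v, the Jacobi identity says that
    the cyclic sum of g u v * f w vanishes. Putting x with f x <> 0 in three,
    two, then one of the places gives g x x = 0, g x v = 0 and g u v = 0; this
    uses that 3 and 2 are invertible. *)
Lemma perfect_eq0 s : sub_superalgebra s ->
  solvable br (parity_part false s) -> bracket_span br s s = s -> s = 0%VS.
Proof.
move=> ssub sol perf; have [hs /(bracket_spanP brl brr) brs] := ssub.
have hpE b x : hp b (hp b x) = hp b x by rewrite (hp_hp sb) eqxx.
have mem0 x : x \in s -> hp false x \in parity_part false s.
  by move=> sx; apply/parity_partP; rewrite hs.
have mem1 x : x \in s -> hp true x \in parity_part true s.
  by move=> sx; apply/parity_partP; rewrite hs.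
have [s10|nz_s1] := eqVneq (parity_part true s) 0%VS.
  suffices es : parity_part false s = s.
    by apply: solvable_perfect perf; rewrite -es.
  apply/eqP; rewrite eqEsubv capvSl; apply/subvP=> x sx.
  rewrite -(hp_sum sb x).
  by have := mem1 x sx; rewrite s10 memv0 => /eqP->; rewrite add0r mem0.
have [f [lam [[x s1x nz_fx] fP]]] := odd_weight_functional ssub sol nz_s1.
have [sx hx] := parity_partP _ _ _ s1x.
have brodd u v : u \in parity_part true s -> v \in parity_part true s ->
    br u v \in parity_part false s.
  move=> /parity_partP[su hu] /parity_partP[sv hv]; apply/parity_partP.
  by rewrite brs // (br_hp sb hu hv).
pose g u v := lam (br u v).
have gC u v : u \in parity_part true s -> v \in parity_part true s -> g u v = g v u.
  move=> /parity_partP[_ hu] /parity_partP[_ hv].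
  by rewrite /g (br_antisym sb hu hv) scaleN1r opprK.
have cyc u v w : u \in parity_part true s -> v \in parity_part true s ->
    w \in parity_part true s -> g u v * f w + g v w * f u + g u w * f v = 0.
  move=> su sv sw; rewrite /g -!fP ?brodd //.
  move: su sv sw => /parity_partP[_ hu] /parity_partP[_ hv] /parity_partP[_ hw].
  rewrite (br_antisym sb hw (br_hp sb hu hv)) (br_jacobi sb hu hv hw).
  rewrite (br_antisym sb hv (br_hp sb hu hw)) !scale1r scaleN1r !linearN linearB /=.
  by rewrite opprB subrK subrr.
have gxx : g x x = 0.
  have := cyc _ _ _ s1x s1x s1x; rewrite -!mulrDl => /eqP.
  rewrite mulf_eq0 (negPf nz_fx) orbF -mulr2n -mulrSr mulrn_eq0 /=.
  by move/eqP.
have gx v : v \in parity_part true s -> g x v = 0.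
  move=> sv; have := cyc _ _ _ s1x s1x sv; rewrite gxx mul0r add0r -mulrDl => /eqP.
  rewrite mulf_eq0 (negPf nz_fx) orbF -mulr2n mulrn_eq0 /=.
  by move/eqP.
have g0 u v : u \in parity_part true s -> v \in parity_part true s -> g u v = 0.
  move=> su sv; have := cyc _ _ _ s1x su sv.
  by rewrite !gx // !mul0r add0r addr0 => /eqP; rewrite mulf_eq0 (negPf nz_fx) orbF => /eqP.
(* lam vanishes on the derived algebra, which is everything. *)
have lam0 y : y \in s -> lam (hp false y) = 0.
  suffices: (bracket_span br s s <= lker (linfun f \o
      linfun (linear_of (brr x)) \o linfun (linear_of (hl false)))%VF)%VS.
    rewrite perf => /subvP sub sy; have := sub _ sy.
    rewrite memv_ker !comp_lfunE (linfunE (hl false)) (linfunE (brr x)) lfunE /=.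
    rewrite fP ?mem0 // mulf_eq0 (negPf nz_fx) orbF.
    by move/eqP.
  apply/(bracket_spanP brl brr)=> {}y z sy sz.
  rewrite memv_ker !comp_lfunE (linfunE (hl false)) (linfunE (brr x)) lfunE /=.
  rewrite -(hp_sum sb y) -(hp_sum sb z) !(linD (brl _)) !(linD (brr _)) !(linD (hl _)).
  rewrite !(hp_id false (br_hp sb (hpE _ y) (hpE _ z))) /= addr0 add0r.
  rewrite (linD (brr _)) linearD /= fP ?brodd ?mem1 // [lam _]g0 ?mem1 // mul0r add0r.
  have := br_jacobi sb hx (hpE false y) (hpE false z); rewrite scale1r.
  move/(canLR (addrK _)) => <-; rewrite linearB /=.
  have brx z' : z' \in parity_part false s -> br x z' \in parity_part true s.
    move=> /parity_partP[sz' hz']; apply/parity_partP.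
    by rewrite brs // (br_hp sb hx hz').
  by rewrite !fP ?brx ?mem0 // mulrCA subrr.
have f0 y : y \in s -> f (hp true y) = 0.
  suffices: (bracket_span br s s <= lker (linfun f \o linfun (linear_of (hl true)))%VF)%VS.
    rewrite perf => /subvP sub sy; have := sub _ sy.
    by rewrite memv_ker comp_lfunE (linfunE (hl true)) lfunE /= => /eqP.
  apply/(bracket_spanP brl brr)=> {}y z sy sz.
  rewrite memv_ker comp_lfunE (linfunE (hl true)) lfunE /=.
  rewrite -(hp_sum sb y) -(hp_sum sb z) !(linD (brl _)) !(linD (brr _)) !(linD (hl _)).
  rewrite !(hp_id true (br_hp sb (hpE _ y) (hpE _ z))) /= add0r addr0.
  rewrite (br_antisym sb (hpE false y) (hpE true z)) /= scale1r.
  by rewrite linearD linearN /= !fP ?mem0 ?mem1 // !lam0 // !mul0r oppr0 addr0.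
by have := f0 x sx; rewrite hx => /eqP; rewrite (negPf nz_fx).
Qed.

(** By [perfect_eq0] the derived algebra of a nonzero s is strictly smaller, and
    it inherits the hypotheses. *)
Theorem superalgebra_solvable s : sub_superalgebra s ->
  solvable br (parity_part false s) -> solvable br s.
Proof.
have [m] := ubnP (\dim s); elim: m s => // m IHm s le_m ssub sol.
have [-> | nz_s] := eqVneq s 0%VS; first by exists 0%N.
have ders : (bracket_span br s s <= s)%VS by case: ssub.
apply/solvable_derived/IHm; last 2 first.
- exact: sub_superalgebra_derived.
- by apply: solvableS sol => //; apply: capvS.
apply: leq_trans (le_m : (\dim s <= m)%N).
rewrite ltn_neqAle (dimv_leqif_eq ders) dimvS // andbT.
by apply: contraNneq nz_s => /(perfect_eq0 ssub sol)->.
Qed.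

End Kac.

(** * Adding positive degrees keeps solvability *)

Section Filtration.
Variables (K : fieldType) (T : vectType K) (br : T -> T -> T).
Hypothesis (brl : forall y, linear (br^~ y)) (brr : forall x, linear (br x)).
Variables (n : nat) (gr : nat -> {vspace T}).
Hypothesis br_gr : forall i j x y, x \in gr i -> y \in gr j -> br x y \in gr (i + j)%N.
Hypothesis gr_large : forall i, (n <= i)%N -> gr i = 0%VS.
Implicit Types (x y : T) (u s : {vspace T}).

Definition degree_ge j : {vspace T} := (\sum_(i < n | (j <= i)%N) gr i)%VS.

Lemma gr_degree_ge i j : (j <= i)%N -> (gr i <= degree_ge j)%VS.
Proof.
move=> le_ji; have [lt_in|/gr_large->] := ltnP i n; last exact: sub0v.
exact: (sumv_sup (Ordinal lt_in)).
Qed.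

Lemma degree_geS i j : (j <= i)%N -> (degree_ge i <= degree_ge j)%VS.
Proof.
move=> le_ji; apply/subv_sumP=> k le_ik.
by apply: gr_degree_ge (leq_trans le_ji le_ik).
Qed.

Lemma br_degree_ge i j x y : x \in degree_ge i -> y \in degree_ge j ->
  br x y \in degree_ge (i + j).
Proof.
move=> /memv_sumP[xs xsP ->] /memv_sumP[ys ysP ->].
rewrite (lin_sum (brl _)) memv_suml // => k le_ik.
rewrite (lin_sum (brr _)) memv_suml // => l le_jl.
apply: subvP (br_gr (xsP k le_ik) (ysP l le_jl)).
by apply: gr_degree_ge; apply: leq_add.
Qed.

(** The m-th derived algebra lies in degrees greater than m. *)
Lemma solvable_degree_ge1 : solvable br (degree_ge 1).
Proof.
exists n; apply/eqP; rewrite -subv0.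
have sub m : (iter m (fun u => bracket_span br u u) (degree_ge 1) <= degree_ge m.+1)%VS.
  elim: m => // m IHm; apply: subv_trans (bracket_spanS brl brr IHm IHm) _.
  apply/(bracket_spanP brl brr)=> x y xm ym.
  by apply: subvP (br_degree_ge xm ym); apply: degree_geS; lia.
apply: subv_trans (sub n) _; apply/subv_sumP=> i lt_ni.
by have := ltn_ord i; rewrite ltnNge (ltnW lt_ni).
Qed.

(** Modulo the ideal of positive degrees the derived series is that of s, so it
    ends inside that ideal. *)
Lemma solvable_add_degree_ge1 s : (s <= gr 0%N)%VS ->
  (bracket_span br s s <= s)%VS -> solvable br s -> solvable br (s + degree_ge 1).
Proof.
move=> s_gr brs [m sol].
have sub k : (iter k (fun u => bracket_span br u u) (s + degree_ge 1)
    <= iter k (fun u => bracket_span br u u) s + degree_ge 1)%VS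
  /\ (iter k (fun u => bracket_span br u u) s <= s)%VS.
  elim: k => // k [IHk IHs]; split; last first.
    exact: subv_trans (bracket_spanS brl brr IHs IHs) brs.
  apply: subv_trans (bracket_spanS brl brr IHk IHk) _; rewrite [iter k.+1 _ s]/=.
  move: (iter k _ s) IHs => u us.
  have u0 x : x \in u -> x \in degree_ge 0.
    by move/(subvP us)/(subvP s_gr); apply/subvP/gr_degree_ge.
  apply/(bracket_spanP brl brr)=> _ _ /memv_addP[x ux [x1 Fx1 ->]] /memv_addP[y uy [y1 Fy1 ->]].
  rewrite (linD (brr _)) !(linD (brl _)) -addrA memv_add ?memv_bracket //.
  have b01 : br x y1 \in degree_ge 1 := br_degree_ge (u0 x ux) Fy1.
  have b10 : br x1 y \in degree_ge 1 := br_degree_ge Fx1 (u0 y uy).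
  have b11 : br x1 y1 \in degree_ge 1.
    by apply: (subvP (@degree_geS 2 1 _)) (br_degree_ge Fx1 Fy1).
  by rewrite !rpredD.
have [{}sub _] := sub m; rewrite sol add0v in sub.
have [k sol1] := solvableS brl brr sub solvable_degree_ge1.
by exists (k + m)%N; rewrite iterD.
Qed.

End Filtration.

(** * Parity and the supercommutator on gl *)

Section Supercommutator.
Import VectorInternalTheory.
Variables (K : fieldType) (V : vectType K).
Implicit Types D E F : 'End(V).
Definition supercomm (e : bool) D E := (D \o E - (-1) ^+ e *: (E \o D))%VF.
(** Associativity of composition only: in coordinates both sides are the same
    signed sum of the six composites of D, E and F. *)
Lemma supercomm_jacobi (a b c : bool) D E F :
  supercomm ((a (+) b) && c) (supercomm (a && b) D E) F =
  supercomm (a && (b (+) c)) D (supercomm (b && c) E F) +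
  (-1) ^+ (b && c) *: supercomm ((a (+) c) && b) (supercomm (a && c) D F) E.
Proof.
rewrite /supercomm !(comp_lfunDl, comp_lfunDr, comp_lfunNl, comp_lfunNr).
rewrite -!(comp_lfunZl, comp_lfunZr) !comp_lfunA.
move: ((D \o E) \o F)%VF ((E \o D) \o F)%VF ((D \o F) \o E)%VF.
move: ((F \o D) \o E)%VF ((E \o F) \o D)%VF ((F \o E) \o D)%VF.
move=> f1 f2 f3 f4 f5 f6; apply/lfunP=> x.
rewrite !(add_lfunE, opp_lfunE, scale_lfunE).
move: (f1 x) (f2 x) (f3 x) (f4 x) (f5 x) (f6 x) => {f1 f2 f3 f4 f5 f6} f1 f2 f3 f4 f5 f6.
apply: v2r_inj; apply/rowP=> i.
have vD u v : v2r (u + v) 0 i = v2r u 0 i + v2r v 0 i by rewrite linearD mxE.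
have vN u : v2r (- u) 0 i = - v2r u 0 i by rewrite linearN mxE.
have vZ k u : v2r (k *: u) 0 i = k * v2r u 0 i by rewrite linearZ mxE.
rewrite !(vD, vN, vZ).
by case: a; case: b; case: c => /=; rewrite ?expr0 ?expr1; ring.
Qed.

End Supercommutator.

Section Parity.
Variables (K : fieldType) (n : nat).
Implicit Types (D E F : gl K n) (f g : Grass K n) (u v s t : {vspace gl K n}).

Lemma hpartB b D E : hpart b (D - E) = hpart b D - hpart b E.
Proof. exact: linB (hpart_is_linear b) D E. Qed.
Lemma hpartZ b k D : hpart b (k *: D) = k *: hpart b D.
Proof. exact: linZ (hpart_is_linear b) k D. Qed.
Lemma sbracketZr D a E : sbracket D (a *: E) = a *: sbracket D E.
Proof. exact: linZ (sbracketr_is_linear D) a E. Qed.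
Lemma sbracketZl a D E : sbracket (a *: D) E = a *: sbracket D E.
Proof. exact: linZ (sbracketl_is_linear E) a D. Qed.

Lemma gpart_gpart b c f : gpart b (gpart c f) = if b == c then gpart b f else 0.
Proof.
have [<-|nbc] := eqVneq b c; apply/ffunP=> A; rewrite !ffunE.
  by case: ifP => // ->.
by case: ifP => // /eqP ->; rewrite (negPf nbc).
Qed.

Lemma gpart_sum f : \sum_b gpart b f = f.
Proof.
rewrite big_bool; apply/ffunP=> A; rewrite !ffunE.
by case: (odd _); rewrite ?addr0 ?add0r.
Qed.

Lemma hpartE b D f : hpart b D f = \sum_c gpart (b (+) c) (D (gpart c f)).
Proof.
rewrite /hpart sum_lfunE; apply: eq_bigr => c _.
by rewrite !comp_lfunE !lfunE.
Qed.

(** hpart b D collects the blocks of D that shift the parity of the argument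
    by b. *)
Lemma hpartP b D :
  hpart b D = D <-> (forall c f, D (gpart c f) = gpart (b (+) c) (D f)).
Proof.
split=> [hD c f|hD]; last first.
  apply/lfunP=> f; rewrite hpartE (eq_bigr (fun c => D (gpart c f))) => [|c _].
    by rewrite -linear_sum gpart_sum.
  by rewrite hD gpart_gpart eqxx.
rewrite -{1}hD -{2}hD !hpartE linear_sum; apply: eq_bigr => e _.
rewrite /= !gpart_gpart (inj_eq (@addbI b)) eq_sym.
by case: eqP => [->//|_]; rewrite !linear0.
Qed.

Lemma hpart_hpart b c D : hpart b (hpart c D) = if b == c then hpart b D else 0.
Proof.
apply/lfunP=> f; rewrite hpartE.
rewrite (eq_bigr (fun e => gpart (b (+) e) (gpart (c (+) e) (D (gpart e f))))).
  case: eqP => [<-|/eqP nbc].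
    by rewrite hpartE; apply: eq_bigr => e _; rewrite gpart_gpart eqxx.
  rewrite zero_lfunE big1 // => e _.
  by rewrite gpart_gpart (inj_eq (@addIb e)) (negPf nbc).
move=> e _; rewrite hpartE linear_sum (bigD1 e) //= [gpart e (gpart e _)]gpart_gpart eqxx.
rewrite big1 ?addr0 // => e' /negPf ne.
by rewrite [gpart e' _]gpart_gpart ne !linear0.
Qed.

Lemma hpart_sum D : \sum_b hpart b D = D.
Proof.
apply/lfunP=> f; rewrite sum_lfunE.
rewrite (eq_bigr (fun b => \sum_c gpart (b (+) c) (D (gpart c f)))); last first.
  by move=> b _; rewrite hpartE.
rewrite exchange_big /= -[in RHS](gpart_sum f) linear_sum; apply: eq_bigr => c _.
rewrite -[RHS]gpart_sum (reindex_inj (@addIb c)) /=.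
by apply: eq_bigr => b _; rewrite -addbA addbb addbF.
Qed.

Lemma hpart_id b c D : hpart c D = D -> hpart b D = if b == c then D else 0.
Proof. by move=> hD; rewrite -hD hpart_hpart; case: eqP => [->|]; rewrite ?hD. Qed.

Lemma hpart_comp a b D E : hpart a D = D -> hpart b E = E ->
  hpart (a (+) b) (D \o E)%VF = (D \o E)%VF.
Proof.
move=> /hpartP hD /hpartP hE; apply/hpartP=> c f.
by rewrite !comp_lfunE hE hD addbA.
Qed.

Lemma sbracketE a b D E : hpart a D = D -> hpart b E = E ->
  sbracket D E = (D \o E)%VF - (-1) ^+ (a && b) *: (E \o D)%VF.
Proof.
move=> hD hE; rewrite /sbracket (bigD1 a) //= [X in _ + X]big1 ?addr0 => [|c nca].
  rewrite (bigD1 b) //= big1 ?addr0 ?hD ?hE // => c /negPf ncb.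
  by rewrite (hpart_id c hE) ncb comp_lfun0l comp_lfun0r scaler0 subr0.
rewrite big1 // => e _; rewrite (hpart_id c hD) (negPf nca).
by rewrite comp_lfun0l comp_lfun0r scaler0 subr0.
Qed.

Lemma hpart_sbracket a b D E : hpart a D = D -> hpart b E = E ->
  hpart (a (+) b) (sbracket D E) = sbracket D E.
Proof.
move=> hD hE; rewrite (sbracketE hD hE); have eD := hpart_comp hD hE.
have := hpart_comp hE hD; rewrite [b (+) a]addbC => eE.
by rewrite hpartB hpartZ eD eE.
Qed.

Lemma sbracketC a b D E : hpart a D = D -> hpart b E = E ->
  sbracket D E = - ((-1) ^+ (a && b) *: sbracket E D).
Proof.
move=> hD hE; rewrite (sbracketE hD hE) (sbracketE hE hD) scalerBr scalerA andbC.
by rewrite -signr_addb addbb scale1r opprB.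
Qed.

Lemma super_jacobi a b c D E F :
  hpart a D = D -> hpart b E = E -> hpart c F = F ->
  sbracket (sbracket D E) F =
    sbracket D (sbracket E F) + (-1) ^+ (b && c) *: sbracket (sbracket D F) E.
Proof.
move=> hD hE hF.
rewrite (sbracketE (hpart_sbracket hD hE) hF) (sbracketE hD (hpart_sbracket hE hF)).
rewrite (sbracketE (hpart_sbracket hD hF) hE).
by rewrite (sbracketE hD hE) (sbracketE hE hF) (sbracketE hD hF); apply: supercomm_jacobi.
Qed.

End Parity.

(** * Prolongs of a maximal solvable degree 0 part *)

Lemma gl_super_bracket (K : fieldType) (n : nat) :
  super_bracket (@sbracket K n) (@hpart K n).
Proof.
split.
- exact: sbracketl_is_linear.
- exact: sbracketr_is_linear.
- exact: hpart_is_linear.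
- exact: hpart_hpart.
- by move=> x; rewrite -[RHS]hpart_sum big_bool.
- exact: hpart_sbracket.
- exact: sbracketC.
- exact: super_jacobi.
Qed.

Lemma lie_solvableS (K : fieldType) (n : nat) (u v : {vspace gl K n}) :
  (u <= v)%VS -> lie_solvable v -> lie_solvable u.
Proof. exact: solvableS (@sbracketl_is_linear K n) (@sbracketr_is_linear K n) u v. Qed.

(** The hypotheses on gr are what a grading of a finite-dimensional subalgebra
    of vect(0|n) by the degree of vector fields provides. *)
Section Prolongation.
Variables (K : numClosedFieldType) (n : nat).
Variables (gr : int -> {vspace gl K n}) (g s0 : {vspace gl K n}).
Hypothesis n_gt0 : (0 < n)%N.
Hypothesis gr_sub : forall d, (gr d <= g)%VS.
Hypothesis gr_parity : forall d D, D \in gr d -> hpart (odd `|d|%N) D = D.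
Hypothesis gr_bracket : forall a b D E,
  D \in gr a -> E \in gr b -> sbracket D E \in gr (a + b).
Hypothesis gr_out : forall d, (d < -1) || (n%:Z <= d) -> gr d = 0%VS.
Hypothesis gr_independent : forall us : 'I_n.+1 -> gl K n,
  (forall i, us i \in gr (i%:Z - 1)) -> \sum_i us i = 0 -> forall i, us i = 0.
Hypothesis s0_max : maximal_solvable_subalgebra (gr 0) s0.

Local Notation gm1 := (gr (-1)).
Local Notation b := (prolong_comp gr gm1 s0).
Local Notation s := (prolong gr gm1 s0).

Lemma prolong_comp_gr k : (b k <= gr k%:Z)%VS.
Proof. by case: k => [|k]; [case: s0_max => -[] | apply: capvSl]. Qed.

Lemma prolong_comp_par k D : D \in b k -> hpart (odd k) D = D.
Proof. by move/(subvP (prolong_comp_gr k))/gr_parity. Qed.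

Lemma gm1_par D : D \in gm1 -> hpart true D = D.
Proof. by move/gr_parity. Qed.

(** Induction on k + l. The Jacobi identity writes [[D, E], v] with v of degree
    -1 through [E, v] and [D, v], each of degree one less; when k or l is 0 that
    bracket falls into degree -1 and the defining property of the prolong
    applies directly. *)
Lemma prolong_comp_bracket k l D E :
  D \in b k -> E \in b l -> sbracket D E \in b (k + l)%N.
Proof.
have [m] := ubnP (k + l)%N; elim: m k l D E => // m IHm k l D E le_m bD bE.
have grD := subvP (prolong_comp_gr k) _ bD.
have grE := subvP (prolong_comp_gr l) _ bE.
case def_kl: (k + l)%N => [|kl].
  have [k0 l0] : k = 0%N /\ l = 0%N by lia.
  move: bD bE; rewrite k0 l0; case: s0_max => -[_ /brvP brs0 _] _; exact: brs0.
apply/memv_prolong_comp; split; first by rewrite -def_kl PoszD; apply: gr_bracket.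
move=> v gv; rewrite (super_jacobi (prolong_comp_par bD) (prolong_comp_par bE) (gm1_par gv)).
have lower j F : F \in b j -> if j is j'.+1 then sbracket F v \in b j'
                              else sbracket F v \in gm1.
  case: j => [|j] bF; last by have [_] := (memv_prolong_comp _ _ _ _ _).1 bF; apply.
  by have := gr_bracket (subvP (prolong_comp_gr 0) _ bF) gv; rewrite add0r.
have bm1_lower j F w : F \in b j.+1 -> w \in gm1 -> sbracket F w \in b j.
  by move=> bF gw; have [_] := (memv_prolong_comp _ _ _ _ _).1 bF; apply.
rewrite rpredD //.
  have := lower l E bE; case: l {bE grE lower} le_m def_kl => [|l] le_m def_kl bEv.
    by rewrite (_ : k = kl.+1) in bD *; [apply: bm1_lower | lia].
  by rewrite (_ : kl = k + l)%N; [apply: IHm => //; lia | lia].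
rewrite memvZ //; have := lower k D bD.
case: k {bD grD lower} le_m def_kl => [|k] le_m def_kl bDv.
  rewrite (sbracketC (gm1_par bDv) (prolong_comp_par bE)) memvN memvZ //.
  by rewrite (_ : l = kl.+1) in bE *; [apply: bm1_lower | lia].
by rewrite (_ : kl = k + l)%N; [apply: IHm => //; lia | lia].
Qed.

(** The components of the prolong numbered from 0, so that degree -1 has
    index 0. *)
Definition prolong_part i := if i is k.+1 then b k else gm1.

Lemma prolongE : s = (\sum_(i < n.+1) prolong_part i)%VS.
Proof. by rewrite big_ord_recl. Qed.

Lemma prolong_part_gr i : (prolong_part i <= gr (i%:Z - 1))%VS.
Proof.
case: i => [|k] //; rewrite (_ : k.+1%:Z - 1 = k); last by lia.
exact: prolong_comp_gr.
Qed.

Lemma prolong_part_sub i : (prolong_part i <= s)%VS.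
Proof.
have [lt_in|le_ni] := ltnP i n.+1.
  by rewrite prolongE; apply: (sumv_sup (Ordinal lt_in)).
apply: subv_trans (prolong_part_gr i) _; rewrite gr_out ?sub0v //.
by apply/orP; right; lia.
Qed.

Lemma prolong_part_bracket i j D E :
  D \in prolong_part i -> E \in prolong_part j -> sbracket D E \in s.
Proof.
have up k D' E' : D' \in b k -> E' \in gm1 -> sbracket D' E' \in s.
  case: k => [|k] bD gE.
    apply: (subvP (prolong_part_sub 0)).
    by have := gr_bracket (subvP (prolong_comp_gr 0) _ bD) gE; rewrite add0r.
  apply: (subvP (prolong_part_sub k.+1)).
  by have [_] := (memv_prolong_comp _ _ _ _ _).1 bD; apply.
case: i j => [|k] [|l] /=.
- move=> gD /(gr_bracket gD); rewrite gr_out // memv0 => /eqP->; exact: mem0v.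
- move=> gD bE; rewrite (sbracketC (gm1_par gD) (prolong_comp_par bE)).
  by rewrite memvN; apply/memvZ/(up l)/gD.
- exact: up.
move=> bD /(prolong_comp_bracket bD); exact: (subvP (prolong_part_sub (k + l).+1)).
Qed.

Lemma prolong_subsuperalgebra : subsuperalgebra s.
Proof.
split=> [c D|]; last first.
  apply/brvP=> D E; rewrite prolongE => /memv_sumP[Ds DsP ->] /memv_sumP[Es EsP ->].
  rewrite (lin_sum (sbracketl_is_linear _)) memv_suml // => i _.
  rewrite (lin_sum (sbracketr_is_linear _)) memv_suml // => j _.
  by rewrite -prolongE; apply: prolong_part_bracket (DsP i isT) (EsP j isT).
rewrite prolongE => /memv_sumP[Ds DsP ->].
rewrite (lin_sum (hpart_is_linear c)) memv_suml // => i _; rewrite -prolongE.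
rewrite (hpart_id c (gr_parity (subvP (prolong_part_gr i) _ (DsP i isT)))).
by case: ifP => _; rewrite ?mem0v // (subvP (prolong_part_sub i)) ?DsP.
Qed.

Lemma prolong_graded : graded gr s.
Proof.
exists [seq i%:Z - 1 | i : 'I_n.+1 <- index_enum 'I_n.+1].
  have : directv (\sum_(i < n.+1) (s :&: gr (i%:Z - 1))).
    apply/directv_sum_independent => us usP us0 i _.
    by apply: gr_independent us0 _ => j; case/memv_capP: (usP j isT).
  by rewrite !directvE /= !big_map.
apply/eqP; rewrite big_map eqEsubv; apply/andP; split.
  rewrite {1}prolongE; apply/subv_sumP=> i _; apply: (sumv_sup i) => //.
  by rewrite subv_cap prolong_part_sub prolong_part_gr.
by apply/subv_sumP=> i _; apply: capvSl.
Qed.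

(** The even part of the prolong has no component of degree -1, which is odd, so
    it lies in s0 plus positive degrees. *)
Lemma prolong_solvable : lie_solvable s.
Proof.
have step := @superalgebra_solvable K _ _ _ (gl_super_bracket K n) s prolong_subsuperalgebra.
apply: step.
pose grN (i : nat) := gr i%:Z.
have grN_br i j D E : D \in grN i -> E \in grN j -> sbracket D E \in grN (i + j)%N.
  by move=> gD gE; rewrite /grN PoszD; apply: gr_bracket.
have grN_out i : (n <= i)%N -> grN i = 0%VS.
  by move=> le_ni; rewrite /grN gr_out // lez_nat le_ni orbT.
have [[s0_gr brs0 sol0] _] := s0_max.
apply: solvableS (solvable_add_degree_ge1 (@sbracketl_is_linear K n)
    (@sbracketr_is_linear K n) grN_br grN_out s0_gr brs0 sol0).
- exact: sbracketl_is_linear.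
- exact: sbracketr_is_linear.
apply/subvP=> D /parity_partP[]; rewrite prolongE => /memv_sumP[Ds DsP ->] <-.
rewrite (lin_sum (hpart_is_linear false)) memv_suml // => i _.
have mem := DsP i isT.
rewrite (hpart_id false (gr_parity (subvP (prolong_part_gr i) _ mem))).
case: ifP => hi; last exact: mem0v.
case: (nat_of_ord i) mem hi => [|[|k]] //= mem _.
  exact: (subvP (addvSl _ _)).
apply: (subvP (addvSr _ _)); apply: (subvP (@gr_degree_ge _ _ _ _ grN_out k.+1 _ _)) => //.
exact: (subvP (prolong_comp_gr k.+1)).
Qed.

(** A larger t has t_0 = s0 by maximality of s0, and its higher components
    satisfy the recursive condition that defines the prolong. *)
Theorem prolong_maximal_solvable : maximal_solvable gr g s.
Proof.
split.
  split.
  - rewrite prolongE; apply/subv_sumP=> i _.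
    exact: subv_trans (prolong_part_gr i) (gr_sub _).
  - exact: prolong_subsuperalgebra.
  - exact: prolong_graded.
  - exact: prolong_solvable.
move=> t _ [_ brt] [r _ def_t] sol_t sub_st; move/brvP: (brt) => brtP.
have gm1_t : (gm1 <= t)%VS := subv_trans (prolong_part_sub 0) sub_st.
have t0 : s0 = (t :&: gr 0)%VS.
  have [[s0_gr _ _] max0] := s0_max; apply: max0.
  - exact: capvSr.
  - apply/brvP=> D E /memv_capP[tD gD] /memv_capP[tE gE].
    apply/memv_capP; split; first exact: brtP.
    by have := gr_bracket gD gE; rewrite addr0.
  - exact: lie_solvableS (capvSl _ _) sol_t.
  - by rewrite subv_cap s0_gr (subv_trans (prolong_part_sub 1) sub_st).
have t_comp k : (t :&: gr k%:Z <= b k)%VS.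
  elim: k => [|k IHk]; first by rewrite -t0.
  apply/subvP=> D /memv_capP[tD gD]; apply/memv_prolong_comp; split=> // E gE.
  apply: (subvP IHk); apply/memv_capP; split.
    by apply: brtP => //; apply: (subvP gm1_t).
  by have := gr_bracket gD gE; rewrite (_ : k.+1%:Z - 1 = k) //; lia.
apply/eqP; rewrite eqEsubv sub_st /= {1}def_t.
elim/big_rec: _ => [|d W _ sW]; rewrite ?sub0v // subv_add sW andbT.
case: d => [k|[|m]].
- exact: subv_trans (t_comp k) (prolong_part_sub k.+1).
- exact: subv_trans (capvSr _ _) (prolong_part_sub 0).
- by rewrite [gr _]gr_out ?capv0 ?sub0v //; apply/orP; left; lia.
Qed.

End Prolongation.

(** * Monomials of the Grassmann algebra *)

Section Inversions.
Variable n : nat.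
Implicit Types (i : 'I_n) (A B C : {set 'I_n}).

Lemma ninvE A B : ninv A B = \sum_(a in A) \sum_(b in B) (b < a : nat)%N.
Proof.
rewrite pair_big /= /ninv -sum1_card big_mkcond [RHS]big_mkcond /=.
apply: eq_bigr => -[a b] _ /=; rewrite inE /=.
by case: (a \in A) => //=; case: (b \in B) => //=; case: (b < a)%N.
Qed.

Lemma ninvUl A A' B : [disjoint A & A'] ->
  ninv (A :|: A') B = (ninv A B + ninv A' B)%N.
Proof. by move=> dA; rewrite !ninvE -bigU //; apply: eq_bigl => a; rewrite inE. Qed.

Lemma ninvUr A B B' : [disjoint B & B'] ->
  ninv A (B :|: B') = (ninv A B + ninv A B')%N.
Proof.
move=> dB; rewrite !ninvE -big_split /=; apply: eq_bigr => a _.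
by rewrite -bigU //; apply: eq_bigl => b; rewrite inE.
Qed.

(** Each pair (a, b) of A x B is an inversion of exactly one of the two orders. *)
Lemma ninvC A B : [disjoint A & B] -> (ninv A B + ninv B A = #|A| * #|B|)%N.
Proof.
move=> dAB; rewrite !ninvE [X in (_ + X)%N]exchange_big /= -big_split /=.
rewrite -sum_nat_const; apply: eq_bigr => a aA.
rewrite -big_split /= -sum1_card; apply: eq_bigr => b bB.
have : (a != b :> nat) by apply: contraTneq bB => /ord_inj <-; rewrite (disjointFr dAB).
by case: (ltngtP a b).
Qed.

Lemma ninv0l B : ninv set0 B = 0%N.
Proof. by rewrite ninvE big_set0. Qed.
Lemma ninv0r A : ninv A set0 = 0%N.
Proof. by rewrite ninvE big1 // => a _; rewrite big_set0. Qed.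

End Inversions.

Section Grassmann.
Variables (K : fieldType) (n : nat).
Implicit Types (i : 'I_n) (A B C : {set 'I_n}) (f g h : Grass K n) (d e : int).

Local Notation sg A B := ((-1) ^+ ninv A B : K).

Lemma sg_sq A B : sg A B * sg A B = 1.
Proof. by rewrite -expr2 sqrr_sign. Qed.

Lemma sgUl A A' B : [disjoint A & A'] -> sg (A :|: A') B = sg A B * sg A' B.
Proof. by move=> dA; rewrite ninvUl // exprD. Qed.
Lemma sgUr A B B' : [disjoint B & B'] -> sg A (B :|: B') = sg A B * sg A B'.
Proof. by move=> dB; rewrite ninvUr // exprD. Qed.
Lemma sgC A B : [disjoint A & B] -> sg A B = (-1) ^+ (#|A| * #|B|)%N * sg B A.
Proof. by move/ninvC <-; rewrite exprD -mulrA sg_sq mulr1. Qed.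

Lemma mono_sum f : f = \sum_A f A *: mono K A.
Proof.
apply/ffunP=> B; rewrite sum_ffunE (bigD1 B) //= big1 ?addr0 => [|A nAB].
  by rewrite !ffunE eqxx; apply/esym/mulr1.
by rewrite !ffunE eq_sym (negPf nAB); apply: mulr0.
Qed.

(** Degrees are integers, so that the degree of an operator, which can be
    negative, may be added to that of its argument; 0 is homogeneous of every
    degree. *)
Definition homog e f := forall A, f A != 0 -> #|A|%:Z = e.

Lemma hom_ext (V : lmodType K) (F G : Grass K n -> V) e f :
  linear F -> linear G -> (forall A, #|A|%:Z = e -> F (mono K A) = G (mono K A)) ->
  homog e f -> F f = G f.
Proof.
move=> lF lG FG hf; rewrite (mono_sum f) !lin_sum //; apply: eq_bigr => A _.
have [->|/hf/FG eFG] := eqVneq (f A) 0; first by rewrite !linZ // !scale0r.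
by rewrite !linZ // eFG.
Qed.

Lemma mono_ext (V : lmodType K) (F G : Grass K n -> V) :
  linear F -> linear G -> (forall A, F (mono K A) = G (mono K A)) -> F =1 G.
Proof.
move=> lF lG FG f; rewrite (mono_sum f) !lin_sum //; apply: eq_bigr => A _.
by rewrite !linZ // FG.
Qed.

Lemma hom_mono A : homog #|A| (mono K A).
Proof. by move=> B; rewrite !ffunE; have [->|_] := eqVneq B A; rewrite //= eqxx. Qed.

Lemma hom_xi i : homog 1 (xi K i).
Proof. by move=> A /hom_mono->; rewrite cards1. Qed.

Lemma hom0 e : homog e 0.
Proof. by move=> A; rewrite ffunE eqxx. Qed.

Lemma hom_add e f g : homog e f -> homog e g -> homog e (f + g).
Proof.
move=> hf hg A; rewrite ffunE; have [fA0|/hf-> //] := eqVneq (f A) 0.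
by rewrite fA0 add0r => /hg.
Qed.

Lemma homZ e a f : homog e f -> homog e (a *: f).
Proof.
move=> hf A; rewrite ffunE; have [->|/hf-> //] := eqVneq (f A) 0.
by rewrite scaler0 eqxx.
Qed.

Lemma homN e f : homog e f -> homog e (- f).
Proof. by rewrite -scaleN1r; apply: homZ. Qed.

Lemma hom_gmul d e f g : homog d f -> homog e g -> homog (d + e) (gmul f g).
Proof.
move=> hf hg C; rewrite ffunE => nz.
have [A /and3P[sAC nzf nzg]] :
    exists A : {set 'I_n}, [&& A \subset C, f A != 0 & g (C :\: A) != 0].
  apply/existsP; apply: contraNT nz => /existsPn noA; rewrite big1 // => A sAC.
  have := noA A; rewrite sAC /= negb_and !negbK.
  by case/orP=> /eqP->; rewrite ?mul0r ?mulr0 // mulr0.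
by rewrite -(hf _ nzf) -(hg _ nzg) -(cardsID A C) (setIidPr sAC).
Qed.

Lemma hom_gdel e i f : homog e f -> homog (e - 1) (gdel i f).
Proof.
move=> hf B; rewrite ffunE; case: ifP => iB; first by rewrite eqxx.
rewrite mulf_eq0 negb_or => /andP[_ /hf <-].
by rewrite cardsU1 iB add1n; lia.
Qed.

Fact gmull_is_linear g : linear ((@gmul K n)^~ g).
Proof.
move=> a f h; apply/ffunP=> C; rewrite !ffunE scaler_sumr -big_split /=.
apply: eq_bigr => A _; rewrite !ffunE [a *: f _]/(a * _) [a *: (_ * _)]/(a * _).
by rewrite mulrDl mulrDr -mulrA !(mulrCA _ a).
Qed.

Lemma gmul_mono A B : gmul (mono K A) (mono K B) =
  if [disjoint A & B] then sg A B *: mono K (A :|: B) else 0.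
Proof.
apply/ffunP=> C; rewrite ffunE.
have -> : \sum_(A' : {set 'I_n} | A' \subset C)
    sg A' (C :\: A') * (mono K A A' * mono K B (C :\: A')) =
    if A \subset C then sg A (C :\: A) * (C :\: A == B)%:R else 0.
  case: ifP => sAC.
    rewrite (bigD1 A) //= big1 ?addr0 => [|A' /andP[_ /negPf nA]].
      by rewrite !ffunE eqxx mul1r.
    by rewrite !ffunE nA mul0r mulr0.
  rewrite big1 // => A' sA'C; rewrite !ffunE.
  by case: (A' =P A) => [eA|_]; [rewrite -eA sA'C in sAC | rewrite mul0r mulr0].
have [dAB|ndAB] := boolP [disjoint A & B].
  rewrite !ffunE; have [->|nC] := eqVneq C (A :|: B).
    have eB : (A :|: B) :\: A = B.
      by rewrite setDUl setDv set0U; apply/setDidPl; rewrite disjoint_sym.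
    by rewrite subsetUl eB !eqxx.
  rewrite [_ *: _]mulr0; case: ifP => // sAC; case: eqP => [eB|_]; rewrite ?mulr0 //.
  by case/eqP: nC; rewrite -eB -{1}(setIidPr sAC) setID.
rewrite ffunE; case: ifP => // sAC; case: eqP => [eB|_]; rewrite ?mulr0 //.
by case/negP: ndAB; rewrite -eB -setI_eq0 setIDA (setIidPl sAC) setDv.
Qed.

Lemma gdel_mono i A : gdel i (mono K A) =
  if i \in A then sg [set i] (A :\ i) *: mono K (A :\ i) else 0.
Proof.
apply/ffunP=> B; rewrite ffunE; case: ifP => iB.
  case: ifP => iA; rewrite !ffunE //; have [eB|_] := eqVneq B (A :\ i); last exact/esym/mulr0.
  by rewrite eB !inE eqxx in iB.
rewrite ffunE; case: ifP => iA.
  rewrite !ffunE; have [->|nB] := eqVneq B (A :\ i).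
    by rewrite setD1K // eqxx.
  rewrite [_ *: _]mulr0; case: eqP => [eA|_]; last by rewrite mulr0.
  by case/eqP: nB; rewrite -eA setU1K // iB.
rewrite ffunE; case: eqP => [eA|_]; last by rewrite mulr0.
by rewrite -eA !inE eqxx in iA.
Qed.

End Grassmann.

(** * Grassmann multiplication and the Leibniz rule *)

Section Algebra.
Variables (K : fieldType) (n : nat).
Implicit Types (i : 'I_n) (A B C : {set 'I_n}) (f g h : Grass K n) (d e : int).

Local Notation sg A B := ((-1) ^+ ninv A B : K).
Local Notation gml := (@gmull_is_linear K n).
Local Notation gmr := (@gmul_is_linear K n).

Lemma gmul1g f : gmul (mono K set0) f = f.
Proof.
apply: mono_ext f => [||B] //; first exact: gmr.
by rewrite gmul_mono -setI_eq0 set0I eqxx set0U ninv0l scale1r.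
Qed.

Lemma gmulg1 f : gmul f (mono K set0) = f.
Proof.
apply: (mono_ext (gml (mono K set0))) f => [|B] //.
by rewrite gmul_mono -setI_eq0 setI0 eqxx setU0 ninv0r scale1r.
Qed.

Lemma disjointUl A B C : [disjoint A :|: B & C] = [disjoint A & C] && [disjoint B & C].
Proof. by rewrite -!setI_eq0 setIUl setU_eq0. Qed.

Lemma disjointUr A B C : [disjoint C & A :|: B] = [disjoint C & A] && [disjoint C & B].
Proof. by rewrite -!setI_eq0 setIUr setU_eq0. Qed.

Lemma gmulA f g h : gmul (gmul f g) h = gmul f (gmul g h).
Proof.
apply: (mono_ext (F := fun f => gmul (gmul f g) h) (G := fun f => gmul f (gmul g h))) f.
- by move=> a x y; rewrite gml gml.
- exact: gml.
move=> A; apply: (mono_ext (F := fun g => gmul (gmul (mono K A) g) h)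
                          (G := fun g => gmul (mono K A) (gmul g h))) g.
- by move=> a x y; rewrite gmr gml.
- by move=> a x y; rewrite gml gmr.
move=> B; apply: (mono_ext (gmr _) (G := fun h => gmul (mono K A) (gmul (mono K B) h))) h.
  by move=> a x y; rewrite gmr gmr.
move=> C; rewrite !gmul_mono.
have [dAB|ndAB] := boolP [disjoint A & B]; last first.
  rewrite (lin0 (gml _)); have [dBC|_] := boolP [disjoint B & C].
    by rewrite (linZ (gmr _)) gmul_mono disjointUr (negPf ndAB) scaler0.
  by rewrite (lin0 (gmr _)).
rewrite (linZ (gml _)) gmul_mono disjointUl.
have [dBC|_] := boolP [disjoint B & C]; last by rewrite andbF scaler0 (lin0 (gmr _)).
rewrite (linZ (gmr _)) gmul_mono disjointUr dAB andbT /=.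
have [dAC|_] := boolP [disjoint A & C]; last by rewrite !scaler0.
by rewrite !scalerA setUA; congr (_ *: _); rewrite sgUl // sgUr //; ring.
Qed.

Definition par d := odd `|d|%N.

Lemma parD d e : par (d + e) = par d (+) par e.
Proof. rewrite /par; lia. Qed.

Lemma gmulC d e f g : homog d f -> homog e g ->
  gmul f g = (-1) ^+ (par d && par e) *: gmul g f.
Proof.
move=> hf hg.
apply: (hom_ext (F := fun f => gmul f g)
   (G := fun f => (-1) ^+ (par d && par e) *: gmul g f) _ _ _ hf) => [||A eA].
- exact: gml.
- by move=> a x y; rewrite gmr scalerDr !scalerA mulrC.
apply: (hom_ext (F := gmul (mono K A))
   (G := fun g => (-1) ^+ (par d && par e) *: gmul g (mono K A)) _ _ _ hg) => [||B eB].
- exact: gmr.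
- by move=> a x y; rewrite gml scalerDr !scalerA mulrC.
rewrite !gmul_mono disjoint_sym; case: ifP => dBA; last by rewrite scaler0.
rewrite scalerA setUC; congr (_ *: _).
by rewrite sgC 1?disjoint_sym // -signr_odd oddM -eA -eB.
Qed.

Lemma gdel_mono0 i A : i \notin A -> gdel i (mono K A) = 0.
Proof. by move=> niA; rewrite gdel_mono (negPf niA). Qed.

Lemma gdel_monoU1 i A : i \notin A ->
  gdel i (mono K (i |: A)) = sg [set i] A *: mono K A.
Proof. by move=> niA; rewrite gdel_mono setU11 setU1K. Qed.

(** It is enough to treat two monomials. Splitting off xi_i from each factor that
    contains it reduces every sign to a product of values of [sg] on disjoint
    sets. *)
Lemma gdel_gmul i d f g : homog d f ->
  gdel i (gmul f g) = gmul (gdel i f) g + (-1) ^+ par d *: gmul f (gdel i g).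
Proof.
move=> hf.
have dl := @gdel_is_linear K n i.
apply: (hom_ext (F := fun f => gdel i (gmul f g))
   (G := fun f => gmul (gdel i f) g + (-1) ^+ par d *: gmul f (gdel i g)) _ _ _ hf).
- by move=> a x y; rewrite gml dl.
- move=> a x y; rewrite dl !gml !scalerDr !scalerA mulrC addrACA.
  by rewrite -!scalerA -scalerDr.
move=> A eA; apply: (mono_ext (F := fun g => gdel i (gmul (mono K A) g))
   (G := fun g => gmul (gdel i (mono K A)) g + (-1) ^+ par d *: gmul (mono K A) (gdel i g))) g.
- by move=> a x y; rewrite gmr dl.
- move=> a x y; rewrite dl !gmr !scalerDr !scalerA mulrC addrACA.
  by rewrite -!scalerA -scalerDr.
move=> B; rewrite gmul_mono.
have sgd : (-1) ^+ par d = (-1) ^+ #|A| :> K by rewrite -eA signr_odd.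
rewrite sgd {sgd hf eA d dl}.
have gd0 := lin0 (@gdel_is_linear K n i).
have gdZ := linZ (@gdel_is_linear K n i).
have [iA|niA] := boolP (i \in A); have [iB|niB] := boolP (i \in B).
- rewrite -(setD1K iA) -(setD1K iB); move: (setD11 i A) (setD11 i B).
  move: (A :\ i) (B :\ i) => {iA iB}A {}B /negbT niA /negbT niB.
  rewrite !gdel_monoU1 // -setI_eq0.
  have /negPf-> : (i |: A) :&: (i |: B) != set0.
    by apply/set0Pn; exists i; rewrite !inE eqxx.
  rewrite gd0 (linZ (gml _)) (linZ (gmr _)) !gmul_mono.
  rewrite disjointUr disjointUl !(disjoint_sym A [set i]) !disjoints1 ?niA ?niB /=.
  case: ifP => dAB; last by rewrite !scaler0 addr0.
  rewrite setUCA !setUA !scalerA -scalerDl (_ : _ + _ = 0) ?scale0r //.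
  rewrite sgUr ?disjoints1 // sgUl ?disjoints1 // cardsU1 niA exprS.
  rewrite (sgC K (A := A) (B := [set i])) 1?disjoint_sym ?disjoints1 // cards1 muln1.
  have := sg_sq K [set i] A; have := sg_sq K [set i] B.
  move: (sg [set i] A) (sg [set i] B) (sg A B) ((-1) ^+ #|A| : K) => x y z t yy xx.
  transitivity ((x * x) * t * z - (y * y) * t * z); first by ring.
  by rewrite xx yy subrr.
- rewrite -(setD1K iA); move: (setD11 i A); move: (A :\ i) => {iA}A /negbT niA.
  rewrite (gdel_mono0 niB) (lin0 (gmr _)) scaler0 addr0 gdel_monoU1 // (linZ (gml _)) gmul_mono.
  rewrite disjointUl disjoints1 niB /=; case: ifP => dAB; last by rewrite gd0 scaler0.
  rewrite gdZ -setUA gdel_monoU1 ?inE ?negb_or ?niA // !scalerA; congr (_ *: _).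
  rewrite sgUl ?disjoints1 // sgUr //.
  have := sg_sq K [set i] B.
  move: (sg [set i] A) (sg [set i] B) (sg A B) => x y z yy.
  transitivity ((y * y) * (x * z)); [ring | by rewrite yy mul1r].
- rewrite -(setD1K iB); move: (setD11 i B); move: (B :\ i) => {iB}B /negbT niB.
  rewrite (gdel_mono0 niA) (lin0 (gml _)) add0r gdel_monoU1 // (linZ (gmr _)) gmul_mono.
  rewrite disjointUr (disjoint_sym A [set i]) disjoints1 niA /=.
  case: ifP => dAB; last by rewrite gd0 !scaler0.
  rewrite gdZ setUCA gdel_monoU1 ?inE ?negb_or ?niA // !scalerA; congr (_ *: _).
  have diB : [disjoint [set i] & B] by rewrite disjoints1.
  rewrite (sgUr K A diB) (sgUr K [set i] dAB).
  rewrite (sgC K (A := A) (B := [set i])) 1?disjoint_sym ?disjoints1 // cards1 muln1.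
  have := sg_sq K [set i] A.
  move: (sg [set i] A) (sg [set i] B) (sg A B) ((-1) ^+ #|A| : K) => x y z t xx.
  transitivity ((x * x) * (t * y * z)); first by ring.
  by rewrite xx; ring.
rewrite !gdel_mono0 // (lin0 (gml _)) (lin0 (gmr _)) scaler0 addr0.
by case: ifP => _; rewrite ?gd0 // gdZ gdel_mono0 ?scaler0 // inE negb_or niA.
Qed.

End Algebra.

(** * Vector fields are the superderivations *)

Section Superderivations.
Variables (K : fieldType) (n : nat).
Implicit Types (i j : 'I_n) (A B C : {set 'I_n}) (f g h : Grass K n) (a d e : int).
Implicit Types (D E : gl K n).

Local Notation gml := (@gmull_is_linear K n).
Local Notation gmr := (@gmul_is_linear K n).

Lemma lmulE f g : lmul f g = gmul f g. Proof. exact: lfunE. Qed.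
Lemma delE i f : del K i f = gdel i f. Proof. exact: lfunE. Qed.

Lemma lfun_linear D : linear D. Proof. by move=> a x y; rewrite linearP. Qed.

(** The first clause ties the parity of D to that of d, which is what the sign
    in the second one refers to. *)
Definition superder d D :=
  (forall e f, homog e f -> homog (d + e) (D f)) /\
  (forall e f g, homog e f ->
     D (gmul f g) = gmul (D f) g + (-1) ^+ (par d && par e) *: gmul f (D g)).

Lemma gpart_hom c e f : homog e f -> gpart c f = if par e == c then f else 0.
Proof.
move=> hf; apply/ffunP=> A; rewrite ffunE.
have [fA0|/hf eA] := eqVneq (f A) 0; first by case: ifP; case: ifP; rewrite ?fA0 ?ffunE.
by rewrite -eA /par /=; case: ifP; rewrite ?ffunE.
Qed.

Lemma superder_hpart d D : superder d D -> hpart (par d) D = D.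
Proof.
case=> homD _; apply/hpartP=> c f.
apply: (mono_ext (F := fun f => D (gpart c f)) (G := fun f => gpart (par d (+) c) (D f))) f.
- by move=> a x y; rewrite gpart_is_linear lfun_linear.
- by move=> a x y; rewrite lfun_linear gpart_is_linear.
move=> A; have hA := @hom_mono K n A; rewrite (gpart_hom _ hA) (gpart_hom _ (homD _ _ hA)).
rewrite parD (inj_eq (@addbI _)).
by case: ifP => // _; rewrite linear0.
Qed.

Lemma sbracket_superderE d e D E f : superder d D -> superder e E ->
  sbracket D E f = D (E f) - (-1) ^+ (par d && par e) *: E (D f).
Proof.
move=> /superder_hpart hD /superder_hpart hE; rewrite (sbracketE hD hE).
by rewrite add_lfunE opp_lfunE scale_lfunE !comp_lfunE.
Qed.

Lemma superder_del i : superder (-1) (del K i).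
Proof.
split=> [e f hf|e f g hf]; rewrite !delE; first by rewrite addrC; apply: hom_gdel.
exact: gdel_gmul.
Qed.

Lemma superder_lmul a f d D : homog a f -> superder d D ->
  superder (a + d) (lmul f \o D)%VF.
Proof.
move=> hf [homD derD]; split=> [e g hg|e g h hg]; rewrite !comp_lfunE !lmulE.
  by rewrite -addrA; apply/hom_gmul/homD.
rewrite (derD _ _ _ hg) (linD (gmr f)) (linZ (gmr f)) -!gmulA; congr (_ + _).
rewrite (gmulC hf hg) (linZ (gml _)) scalerA; congr (_ *: _).
by rewrite parD andb_addl signr_addb mulrC.
Qed.

Lemma superder0 d : superder d 0.
Proof.
split=> [e f _|e f g _]; rewrite !zero_lfunE; first exact: hom0.
by rewrite (lin0 (gml _)) (lin0 (gmr _)) scaler0 addr0.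
Qed.

Lemma superderZ d k D : superder d D -> superder d (k *: D).
Proof.
case=> homD derD; split=> [e f hf|e f g hf]; rewrite !scale_lfunE.
  exact/homZ/homD.
rewrite (derD _ _ _ hf) (linZ (gml _)) (linZ (gmr _)) scalerDr.
by rewrite !scalerA mulrC.
Qed.

Lemma superderD d D E : superder d D -> superder d E -> superder d (D + E).
Proof.
move=> [homD derD] [homE derE]; split=> [e f hf|e f g hf]; rewrite !add_lfunE.
  by apply: hom_add (homD _ _ hf) (homE _ _ hf).
rewrite (derD _ _ _ hf) (derE _ _ _ hf) (linD (gml _)) (linD (gmr _)) scalerDr.
by rewrite addrACA.
Qed.

Lemma superder_sum d I (r : seq I) (P : pred I) (F : I -> gl K n) :
  (forall k, P k -> superder d (F k)) -> superder d (\sum_(k <- r | P k) F k).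
Proof.
by move=> hF; elim/big_rec: _ => [|k D Pk]; [apply: superder0 | apply/superderD/hF].
Qed.

Lemma superder_sbracket d e D E : superder d D -> superder e E ->
  superder (d + e) (sbracket D E).
Proof.
move=> sD sE; have [homD derD] := sD; have [homE derE] := sE.
split=> [c f hf|c f g hf]; rewrite !(sbracket_superderE _ sD sE).
  apply: hom_add; first by rewrite -addrA; apply/homD/homE.
  apply/homN/homZ; rewrite (addrC d) -addrA; exact/homE/homD.
rewrite (derE _ _ _ hf) (derD _ _ _ hf) !(linD (lfun_linear _)) !(linZ (lfun_linear _)).
rewrite (derD _ _ _ (homE _ _ hf)) (derE _ _ _ (homD _ _ hf)) (derD _ _ _ hf) (derE _ _ _ hf).
rewrite (linB (gml _)) (linB (gmr _)) (linZ (gml _)) (linZ (gmr _)) !parD.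
move: (gmul (D (E f)) g) (gmul (E f) (D g)) (gmul (D f) (E g)) (gmul f (D (E g))).
move: (gmul (E (D f)) g) (gmul f (E (D g))) => x1 x2 x3 x4 x5 x6.
apply/ffunP=> A; rewrite !ffunE.
move: (x1 A) (x2 A) (x3 A) (x4 A) (x5 A) (x6 A) => {x1 x2 x3 x4 x5 x6} x1 x2 x3 x4 x5 x6.
have sc (k x : K) : k *: (x : K^o) = k * x by [].
rewrite !sc.
by case: (par d); case: (par e); case: (par c) => /=; rewrite ?expr0 ?expr1; ring.
Qed.

Lemma superder_mono_set0 d D : superder d D -> D (mono K set0) = 0.
Proof.
case=> _ derD; have := derD _ _ (mono K set0) (@hom_mono K n set0).
rewrite cards0 [par _ && _]andbF scale1r !gmul1g gmulg1 => /eqP.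
by rewrite -subr_eq subrr eq_sym => /eqP.
Qed.

(** A monomial is, up to sign, a product of generators. *)
Lemma superder_ext d D E : superder d D -> superder d E ->
  (forall i, D (xi K i) = E (xi K i)) -> D = E.
Proof.
move=> sD sE DE; have [_ derD] := sD; have [_ derE] := sE.
apply/lfunP; apply: mono_ext (lfun_linear D) (lfun_linear E) _ => A.
have [m] := ubnP #|A|; elim: m A => // m IHm A le_m.
have [->|[i iA]] := set_0Vmem A.
  by rewrite (superder_mono_set0 sD) (superder_mono_set0 sE).
have eA : mono K A = (-1) ^+ ninv [set i] (A :\ i) *: gmul (xi K i) (mono K (A :\ i)).
  rewrite /xi gmul_mono disjoints1 setD11 /= scalerA -expr2 sqrr_sign scale1r.
  by rewrite setD1K.
rewrite eA !(linZ (lfun_linear _)) (derD _ _ _ (@hom_xi K n i)) (derE _ _ _ (@hom_xi K n i)).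
by rewrite DE IHm //; move: le_m; rewrite (cardsD1 i) iA.
Qed.

Fact lmul_del_is_linear i : linear (fun f => lmul f \o del K i)%VF.
Proof.
move=> a f g; apply/lfunP=> h; rewrite add_lfunE scale_lfunE !comp_lfunE !lmulE.
exact: gml.
Qed.

Lemma lmul_del_vect d i f : homog (d + 1) f -> (lmul f \o del K i)%VF \in vect_ K n d.
Proof.
move=> hf; rewrite (mono_sum f) (lin_sum (lmul_del_is_linear i)) memv_suml // => A _.
rewrite (linZ (lmul_del_is_linear i)).
have [->|/hf eA] := eqVneq (f A) 0; first by rewrite scale0r mem0v.
apply/memvZ; rewrite /vect_; apply: (subvP (sumv_sup A _ (subvv _))).
  by rewrite eA addrK.
by apply: (subvP (sumv_sup i isT (subvv _))); apply: memv_line.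
Qed.

Lemma del_xi i j : gdel i (xi K j) = if i == j then mono K set0 else 0.
Proof.
rewrite /xi gdel_mono !inE; case: eqP => // ->.
by rewrite setDv ninv0r scale1r.
Qed.

(** Both sides are superderivations with the same values on the generators. *)
Lemma superderE d D : superder d D ->
  D = \sum_i (lmul (D (xi K i)) \o del K i)%VF.
Proof.
move=> sD; have [homD _] := sD; apply: superder_ext (sD) _ _ => [|j].
  apply: superder_sum => i _; rewrite -[d](addrK 1).
  by apply/superder_lmul/superder_del/homD/hom_xi.
rewrite sum_lfunE (bigD1 j) //= big1 ?addr0 => [|i /negPf nij];
  rewrite comp_lfunE lmulE delE del_xi ?nij ?eqxx ?gmulg1 //.
by rewrite (lin0 (gmr _)).
Qed.

(** This description turns closure properties of vector fields into formal
    properties of superderivations. *)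
Lemma vect_P d D : D \in vect_ K n d <-> superder d D.
Proof.
split=> [|sD]; last first.
  rewrite (superderE sD) memv_suml // => i _; apply: lmul_del_vect.
  by case: sD => homD _; apply/homD/hom_xi.
case/memv_sumP=> Ds DsP ->; apply: superder_sum => A dA.
have /memv_sumP[Es EsP ->] := DsP A dA; rewrite -(eqP dA).
apply: superder_sum => i _; have /vlineP[k ->] := EsP i isT.
apply/superderZ; apply: superder_lmul (superder_del i); exact: hom_mono.
Qed.

End Superderivations.

(** * The general and the divergence-free series *)

Section Vect.
Variables (K : fieldType) (n : nat).
Implicit Types (i j : 'I_n) (A B C : {set 'I_n}) (f g h : Grass K n) (a d e : int).
Implicit Types (D E : gl K n).

Local Notation gml := (@gmull_is_linear K n).
Local Notation gmr := (@gmul_is_linear K n).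

Lemma vect_out d : (d < -1) || (n%:Z <= d) -> vect_ K n d = 0%VS.
Proof.
move=> out; rewrite /vect_ big_pred0 // => A; apply/eqP => eA.
have := subset_leq_card (subsetT A); rewrite cardsT card_ord.
by move: out; rewrite -eA; lia.
Qed.

Lemma vect_independent (us : 'I_n.+1 -> gl K n) :
  (forall k, us k \in vect_ K n (k%:Z - 1)) -> \sum_k us k = 0 -> forall k, us k = 0.
Proof.
move=> us_vect us0 i; have /vect_P su := us_vect i.
apply: (superder_ext su (@superder0 K n _)) => j; rewrite zero_lfunE.
have hom_us (k : 'I_n.+1) : homog k%:Z (us k (xi K j)).
  have /vect_P[homu _] := us_vect k.
  by rewrite -[Posz k](subrK 1); apply/homu/hom_xi.
apply/ffunP=> A; rewrite ffunE; apply/eqP; apply: contraT => nz.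
have := congr1 (fun D : gl K n => D (xi K j) A) us0.
rewrite sum_lfunE sum_ffunE zero_lfunE ffunE (bigD1 i) //= big1 ?addr0 => [eq0|k nki].
  by rewrite eq0 eqxx in nz.
apply/eqP; apply: contraR nki => /hom_us; rewrite (hom_us i A nz) => -[ki].
by apply/eqP/ord_inj.
Qed.

Lemma vect_sub d : (vect_ K n d <= vect K n)%VS.
Proof. by apply/subv_sumP=> A _; apply: (sumv_sup A). Qed.

(** The supercommutator of del_i with D is the superderivation whose value on
    xi_j is del_i (D xi_j), since D kills constants. *)
Lemma chain_rule i d D f : superder d D ->
  gdel i (D f) = \sum_j gmul (gdel i (D (xi K j))) (gdel j f)
                 + (-1) ^+ par d *: D (gdel i f).
Proof.
move=> sD; have sB := superder_sbracket (superder_del K i) sD.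
have brE g : sbracket (del K i) D g = gdel i (D g) - (-1) ^+ par d *: D (gdel i g).
  by rewrite (sbracket_superderE _ (superder_del K i) sD) !delE.
have := brE f; rewrite {1}(superderE sB) => /eqP; rewrite eq_sym subr_eq => /eqP->.
rewrite sum_lfunE; congr (_ + _); apply: eq_bigr => j _.
rewrite comp_lfunE lmulE delE brE del_xi; congr (gmul _ _).
rewrite (_ : D (if i == j then _ else _) = 0) ?scaler0 ?subr0 //.
by case: ifP => _; rewrite ?(superder_mono_set0 sD) ?linear0.
Qed.

Lemma gdelC i j f : gdel i (gdel j f) = - gdel j (gdel i f).
Proof.
have := chain_rule i f (superder_del K j); rewrite !delE => ->.
rewrite big1 ?add0r ?scaleN1r // => k _; rewrite delE del_xi.
case: ifP => _; rewrite ?(lin0 (@gdel_is_linear K n i)) ?gdel_mono0 ?inE //;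
by rewrite (lin0 (gml _)).
Qed.

Lemma gsign_hom e f : homog e f -> gsign f = (-1) ^+ par e *: f.
Proof.
move=> hf; apply/ffunP=> A; rewrite !ffunE.
have [->|/hf <-] := eqVneq (f A) 0; first by rewrite mulr0 scaler0.
by rewrite /par /= signr_odd.
Qed.

(** The divergence without signs; on homogeneous vector fields it differs from
    Div by a sign only. *)
Definition divergence D := \sum_i gdel i (D (xi K i)).

Lemma DivE d D : superder d D -> Div D = - ((-1) ^+ par d *: divergence D).
Proof.
case=> homD _; rewrite /Div /divergence scaler_sumr -sumrN; apply: eq_bigr => i _.
rewrite delE (gsign_hom (homD _ _ (@hom_xi K n i))) (linZ (@gdel_is_linear K n i)).
by rewrite parD addbC signr_addb mulN1r scaleNr.
Qed.

Lemma Div_eq0 d D : superder d D -> (Div D = 0) <-> (divergence D = 0).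
Proof.
move=> /DivE->; split=> [/eqP|->]; last by rewrite scaler0 oppr0.
by rewrite oppr_eq0 scaler_eq0 signr_eq0 => /eqP.
Qed.

Lemma svect_P d D : D \in svect_ K n d <-> superder d D /\ divergence D = 0.
Proof.
rewrite /svect_ /svect !memv_cap memv_ker lfunE /=; split.
  by case/andP=> /andP[_ /eqP div0] /vect_P sD; split=> //; apply/(Div_eq0 sD).
case=> sD /(Div_eq0 sD)/eqP ->; have vD : D \in vect_ K n d by apply/vect_P.
by rewrite vD (subvP (vect_sub d)).
Qed.

(** The second-order terms of the chain rule add up to D (divergence E). *)
Lemma divergence_comp d e D E : superder d D -> superder e E -> divergence E = 0 ->
  \sum_i gdel i (D (E (xi K i))) =
  \sum_i \sum_j gmul (gdel i (D (xi K j))) (gdel j (E (xi K i))).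
Proof.
move=> sD sE divE; under eq_bigr do rewrite (chain_rule _ _ sD).
rewrite big_split /= -scaler_sumr -(lin_sum (lfun_linear D)).
by rewrite -/(divergence E) divE linear0 scaler0 addr0.
Qed.

(** After [divergence_comp] the two halves of the supercommutator are the sums of
    (del_i D xi_j)(del_j E xi_i) in the two orders of the factors, which agree
    up to the sign of the supercommutator. *)
Lemma divergence_sbracket d e D E : superder d D -> superder e E ->
  divergence D = 0 -> divergence E = 0 -> divergence (sbracket D E) = 0.
Proof.
move=> sD sE divD divE; rewrite {1}/divergence.
under eq_bigr => i _.
  rewrite (sbracket_superderE _ sD sE) (linB (@gdel_is_linear K n i)).
  rewrite (linZ (@gdel_is_linear K n i)); over.
rewrite sumrB -scaler_sumr (divergence_comp sD sE divE) (divergence_comp sE sD divD).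
apply/eqP; rewrite subr_eq0; apply/eqP.
rewrite exchange_big scaler_sumr; apply: eq_bigr => i _.
rewrite scaler_sumr; apply: eq_bigr => j _.
have homdel c F k l : superder c F -> homog c (gdel k (F (xi K l))).
  case=> homF _; rewrite -[c](addrK 1); apply/hom_gdel/homF/hom_xi.
by apply: gmulC; [apply: homdel sD | apply: homdel sE].
Qed.

End Vect.

Section VectorFieldProlongs.
Variables (K : numClosedFieldType) (n : nat).

Lemma vector_field_prolong (gr : int -> {vspace gl K n}) (g s0 : {vspace gl K n}) :
  (0 < n)%N -> (forall d, (gr d <= vect_ K n d)%VS) -> (forall d, (gr d <= g)%VS) ->
  (forall d e D E, D \in gr d -> E \in gr e -> sbracket D E \in gr (d + e)) ->
  maximal_solvable_subalgebra (gr 0) s0 ->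
  maximal_solvable gr g (prolong gr (gr (-1)) s0).
Proof.
move=> n_gt0 gr_vect gr_g gr_br s0_max; apply: prolong_maximal_solvable => //.
- by move=> d D /(subvP (gr_vect d))/vect_P/superder_hpart.
- by move=> d out; apply/eqP; rewrite -subv0 -(vect_out K out).
by move=> us us_gr; apply: vect_independent => i; apply: (subvP (gr_vect _)).
Qed.

Lemma vect_prolong (s0 : {vspace gl K n}) : (0 < n)%N ->
  maximal_solvable_subalgebra (vect_ K n 0) s0 ->
  maximal_solvable (vect_ K n) (vect K n) (prolong (vect_ K n) (vect_ K n (-1)) s0).
Proof.
move=> n_gt0; apply: vector_field_prolong => // [d|d e D E /vect_P sD /vect_P sE].
  exact: vect_sub.
exact/vect_P/superder_sbracket.
Qed.

Lemma svect_prolong (s0 : {vspace gl K n}) : (0 < n)%N ->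
  maximal_solvable_subalgebra (svect_ K n 0) s0 ->
  maximal_solvable (svect_ K n) (svect K n) (prolong (svect_ K n) (svect_ K n (-1)) s0).
Proof.
move=> n_gt0; apply: vector_field_prolong => // [d|d|d e D E].
- exact: capvSr.
- exact: capvSl.
move=> /svect_P[sD divD] /svect_P[sE divE]; apply/svect_P.
by split; [apply: superder_sbracket | apply: divergence_sbracket sD sE divD divE].
Qed.

End VectorFieldProlongs.

(** * The Hamiltonian series *)

Section Ham.
Variables (K : fieldType) (k l : nat).
Local Notation n := (k + k + l)%N.
Implicit Types (i j : 'I_n) (A B C : {set 'I_n}) (f g h : Grass K n) (a b d e : int).
Implicit Types (D E : gl K n).

Local Notation gml := (@gmull_is_linear K n).
Local Notation gmr := (@gmul_is_linear K n).
Local Notation ld i := (@gdel_is_linear K n i).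

(** The index of the variable paired with the i-th one by the form that defines
    the Hamiltonian fields: xi and eta are exchanged, each zeta is paired with
    itself. It turns H_f into a single sum ([ham_conjugate]). *)
Definition conjugate_index i : 'I_n :=
  match split i with
  | inl j => match split j with inl p => ieta l p | inr q => ixi l q end
  | inr z => izeta k z
  end.

Lemma conjugate_index_ixi p : conjugate_index (ixi l p) = ieta l p.
Proof. by rewrite /conjugate_index /ixi !(unsplitK (inl _)). Qed.
Lemma conjugate_index_ieta p : conjugate_index (ieta l p) = ixi l p.
Proof. by rewrite /conjugate_index /ieta (unsplitK (inl _)) (unsplitK (inr _)). Qed.
Lemma conjugate_index_izeta z : conjugate_index (izeta k z) = izeta k z.
Proof. by rewrite /conjugate_index /izeta (unsplitK (inr _)). Qed.

Lemma conjugate_indexK : involutive conjugate_index.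
Proof.
move=> i; rewrite -[i]splitK; case: (split i) => [j|z] /=; last by rewrite !conjugate_index_izeta.
rewrite -[j]splitK; case: (split j) => p /=.
  by rewrite -/(ixi l p) conjugate_index_ixi conjugate_index_ieta.
by rewrite -/(ieta l p) conjugate_index_ieta conjugate_index_ixi.
Qed.

Lemma ham_conjugate f :
  ham f = \sum_i (lmul (gdel i (gsign f)) \o del K (conjugate_index i))%VF.
Proof.
rewrite /ham big_split_ord big_split_ord /= -!big_split /=.
congr (_ + _).
  by apply: eq_bigr => p _; rewrite !delE conjugate_index_ixi conjugate_index_ieta.
by apply: eq_bigr => z _; rewrite !delE conjugate_index_izeta.
Qed.

Fact ham_is_linear : linear (@ham K k l).
Proof.
move=> a f g; rewrite !ham_conjugate scaler_sumr -big_split; apply: eq_bigr => i _ /=.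
by rewrite gsign_is_linear (ld i) (lmul_del_is_linear (conjugate_index i)).
Qed.

Lemma ham_xi f j : ham f (xi K j) = gdel (conjugate_index j) (gsign f).
Proof.
rewrite ham_conjugate sum_lfunE (bigD1 (conjugate_index j)) //= big1 ?addr0 => [|i /negPf nij];
  rewrite comp_lfunE lmulE delE del_xi.
  by rewrite conjugate_indexK eqxx gmulg1.
by rewrite (can2_eq conjugate_indexK conjugate_indexK) nij (lin0 (gmr _)).
Qed.

Lemma ham_xi_hom a f j : homog a f -> ham f (xi K j) = (-1) ^+ par a *: gdel (conjugate_index j) f.
Proof. by move=> hf; rewrite ham_xi (gsign_hom hf) (linZ (ld _)). Qed.

Lemma superder_ham a f : homog a f -> superder (a - 2) (ham f).
Proof.
move=> hf; rewrite ham_conjugate; apply: superder_sum => i _.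
rewrite (_ : a - 2 = (a - 1) + -1); last by ring.
apply: superder_lmul (superder_del _ _); apply/hom_gdel.
by rewrite (gsign_hom hf); apply: homZ.
Qed.

Lemma memv_ham d f : homog (d + 2) f -> ham f \in ham_alg_ K k l d.
Proof.
move=> hf; rewrite (mono_sum f) (lin_sum ham_is_linear) memv_suml // => A _.
rewrite (linZ ham_is_linear).
have [->|/hf eA] := eqVneq (f A) 0; first by rewrite scale0r mem0v.
apply/memvZ; rewrite /ham_alg_; apply: (subvP (sumv_sup A _ (subvv _))).
  by rewrite eA addrK.
exact: memv_line.
Qed.

Lemma ham_sub_vect d : (ham_alg_ K k l d <= vect_ K n d)%VS.
Proof.
apply/subv_sumP=> A /eqP <-; apply/subvP=> _ /vlineP[c ->]; apply/memvZ/vect_P.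
exact/superder_ham/hom_mono.
Qed.

(** Two superderivations are compared on the generator xi_i. The right-hand side
    is, up to sign, the derivative of H_f g along the variable conjugate to
    xi_i. In its expansion by the chain rule, the term where H_f acts on the
    derivative of g is, up to sign, H_f (H_g xi_i), and the rest is
    H_g (H_f xi_i) because partial derivatives anticommute. *)
Lemma sbracket_ham a b f g : homog a f -> homog b g ->
  sbracket (ham f) (ham g) = ham (ham f g).
Proof.
move=> hf hg; have sF := superder_ham hf; have sG := superder_ham hg.
have hFg : homog (a + b - 2) (ham f g).
  by case: sF => homF _; rewrite addrAC; apply: homF.
have par2 c : par (c - 2) = par c by rewrite parD addbF.
apply: (@superder_ext K n (a - 2 + (b - 2))).
- exact: superder_sbracket.
- rewrite (_ : _ + _ = a + b - 2 - 2); last by ring.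
  exact: superder_ham.
move=> i; rewrite (sbracket_superderE _ sF sG) (ham_xi_hom _ hFg).
rewrite (ham_xi_hom _ hf) (ham_xi_hom _ hg) !(linZ (lfun_linear _)).
rewrite (chain_rule _ _ sF) scalerDr scalerA !par2 parD.
have -> : \sum_j gmul (gdel (conjugate_index i) (ham f (xi K j))) (gdel j g) =
  - ((-1) ^+ (par a && par b) *: ((-1) ^+ par b *: ham g (gdel (conjugate_index i) f))).
  rewrite (ham_conjugate g) sum_lfunE !scaler_sumr -sumrN; apply: eq_bigr => j _.
  rewrite (ham_xi_hom _ hf) comp_lfunE lmulE delE (gsign_hom hg) !(linZ (ld _)).
  rewrite !(linZ (gml _)) gdelC -scaleN1r (linZ (gml _)).
  rewrite (gmulC (d := a - 1 - 1) (e := b - 1)); last 2 first.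
  - exact/hom_gdel/hom_gdel.
  - exact: hom_gdel.
  rewrite !scalerA -scaleNr; congr (_ *: _); rewrite !parD.
  by case: (par a); case: (par b) => /=; ring.
rewrite (addbC (par a)) scalerN !scalerA addrC; congr (- (_ *: _) + _ *: _);
  by case: (par a); case: (par b) => /=; ring.
Qed.

Lemma ham_bracket d e D E : D \in ham_alg_ K k l d -> E \in ham_alg_ K k l e ->
  sbracket D E \in ham_alg_ K k l (d + e).
Proof.
move=> /memv_sumP[Ds DsP ->] /memv_sumP[Es EsP ->].
rewrite (lin_sum (sbracketl_is_linear _)) memv_suml // => A dA.
rewrite (lin_sum (sbracketr_is_linear _)) memv_suml // => B dB.
have /vlineP[c ->] := DsP A dA; have /vlineP[c' ->] := EsP B dB.
rewrite sbracketZl sbracketZr (sbracket_ham (@hom_mono K n A) (@hom_mono K n B)).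
apply/memvZ/memvZ/memv_ham; have [homA _] := superder_ham (@hom_mono K n A).
have := homA _ _ (@hom_mono K n B); rewrite -(eqP dA) -(eqP dB).
by rewrite (_ : _ - 2 + _ = #|A|%:Z - 2 + (#|B|%:Z - 2) + 2) //; ring.
Qed.

Lemma ham_sub d : (ham_alg_ K k l d <= ham_alg K k l)%VS.
Proof. by apply/subv_sumP=> A _; apply: (sumv_sup A). Qed.

End Ham.

Lemma ham_prolong (K : numClosedFieldType) (k l : nat)
    (s0 : {vspace gl K (k + k + l)}) : (0 < k + k + l)%N ->
  maximal_solvable_subalgebra (ham_alg_ K k l 0) s0 ->
  maximal_solvable (ham_alg_ K k l) (ham_alg K k l)
    (prolong (ham_alg_ K k l) (ham_alg_ K k l (-1)) s0).
Proof.
move=> n_gt0; apply: vector_field_prolong => // [d|d|d e D E].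
- exact: ham_sub_vect.
- exact: ham_sub.
exact: ham_bracket.
Qed.

(** * The deformed divergence-free algebra *)

Section ElementaryFields.
Variables (K : numFieldType) (n : nat).
Implicit Types (i j : 'I_n) (s : {vspace gl K n}).
Local Notation X i j := (lmul (xi K i) \o del K j)%VF.

Lemma superder_X i j : superder 0 (X i j).
Proof. exact: superder_lmul (@hom_xi K n i) (superder_del K j). Qed.

Lemma X_xi i j k : X i j (xi K k) = if j == k then xi K i else 0.
Proof.
rewrite comp_lfunE lmulE delE del_xi; case: ifP => _; first exact: gmulg1.
exact: lin0 (gmul_is_linear _).
Qed.

(** The two fields and their bracket h span a copy of sl(2), with
    [h, e] = 2 e and [h, f] = - 2 f, so all three stay in every derived
    algebra. *)
Lemma not_solvable_sl2 s p q : p != q -> (brv s s <= s)%VS ->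
  X p q \in s -> X q p \in s -> ~ lie_solvable s.
Proof.
move=> npq brs sXpq sXqp [m sol].
pose e := X p q; pose f := X q p; pose h := sbracket e f.
have se : superder 0 e := superder_X p q.
have sf : superder 0 f := superder_X q p.
have sh : superder 0 h by rewrite -[0]addr0; apply: superder_sbracket.
have brE (D E : gl K n) g : superder 0 D -> superder 0 E -> sbracket D E g = D (E g) - E (D g).
  by move=> sD sE; rewrite (sbracket_superderE _ sD sE) scale1r.
have e_xi k : e (xi K k) = if q == k then xi K p else 0 := X_xi p q k.
have f_xi k : f (xi K k) = if p == k then xi K q else 0 := X_xi q p k.
have pq : (p == q) = false := negPf npq.
have qp : (q == p) = false by rewrite eq_sym.
have h_xi k : h (xi K k) = (if p == k then xi K p else 0) - (if q == k then xi K q else 0).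
  rewrite (brE _ _ _ se sf) !(e_xi, f_xi); congr (_ - _).
    by case: ifP => _; rewrite ?(e_xi, f_xi) ?eqxx ?linear0.
  by case: ifP => _; rewrite ?(e_xi, f_xi) ?eqxx ?linear0.
have he : sbracket h e = 2 *: e.
  apply: (superder_ext (d := 0)) => [||k].
  - by rewrite -[0]addr0; apply: superder_sbracket.
  - exact: superderZ.
  rewrite (brE _ _ _ sh se) scale_lfunE h_xi !(e_xi, f_xi).
  have [<-|nqk] := eqVneq q k; last first.
    rewrite linear0 subr0 scaler0; case: ifP => _; last by rewrite linear0 subr0.
    by rewrite e_xi qp subr0.
  rewrite h_xi !eqxx pq qp subr0 sub0r (linN (lfun_linear e)) e_xi eqxx opprK.
  by rewrite scaler_nat.
have hf : sbracket h f = - (2 *: f).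
  apply: (superder_ext (d := 0)) => [||k].
  - by rewrite -[0]addr0; apply: superder_sbracket.
  - by rewrite -scaleN1r; do 2!apply: superderZ.
  rewrite (brE _ _ _ sh sf) opp_lfunE scale_lfunE h_xi !(e_xi, f_xi).
  have [<-|npk] := eqVneq p k; last first.
    rewrite linear0 sub0r scaler0; case: ifP => _; last by rewrite subr0 linear0.
    by rewrite sub0r (linN (lfun_linear f)) f_xi pq !oppr0.
  rewrite h_xi !eqxx pq qp subr0 sub0r f_xi eqxx.
  by rewrite scaler_nat mulr2n opprD.
have nz2 : 2 != 0 :> K by rewrite pnatr_eq0.
have mem_brv (u : {vspace gl K n}) D E : D \in u -> E \in u -> sbracket D E \in brv u u.
  by move=> uD uE; have [brP _] := brvP u u (brv u u); apply: brP.
have [] : [/\ e \in iter m (fun u => brv u u) s, f \in iter m (fun u => brv u u) s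
    & h \in iter m (fun u => brv u u) s].
  elim: m {sol} => [|m [ue uf uh]] /=.
    by split=> //; apply: (subvP brs); apply: mem_brv.
  move: (iter _ _ _) ue uf uh => u ue uf uh; split; last exact: mem_brv.
    by rewrite -[e](scalerK nz2) -he memvZ // mem_brv.
  by rewrite -[f](scalerK nz2) -[2 *: f]opprK -hf memvZ // memvN mem_brv.
rewrite sol memv0 => /eqP e0 _ _.
have := X_xi p q q; rewrite eqxx -/e e0 zero_lfunE => /ffunP/(_ [set p])/eqP.
by rewrite !ffunE eqxx eq_sym oner_eq0.
Qed.

End ElementaryFields.

Section Deformed.
Variables (K : numFieldType) (n : nat).
Hypothesis n_ge2 : (2 <= n)%N.
Local Notation m := (2 * n)%N.
Implicit Types (i j c : 'I_m) (A B : {set 'I_m}) (f g : Grass K m) (s : {vspace gl K m}).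

Local Notation gml := (@gmull_is_linear K m).
Local Notation gmr := (@gmul_is_linear K m).
Local Notation ld i := (@gdel_is_linear K m i).
Local Notation Xi := (mono K (setT : {set 'I_m})).
Local Notation T i := (lmul (oneXi K n) \o del K i)%VF.

Lemma oneXi_mul f : gmul (oneXi K n) f = f + gmul Xi f.
Proof. by rewrite /oneXi (linD (gml f)) gmul1g. Qed.

Lemma mul_oneXi f : gmul f (oneXi K n) = f + gmul f Xi.
Proof. by rewrite /oneXi (linD (gmr f)) gmulg1. Qed.

Lemma oneXi_mono A : A != set0 -> gmul (oneXi K n) (mono K A) = mono K A.
Proof. by move=> nzA; rewrite oneXi_mul gmul_mono -setI_eq0 setTI (negPf nzA) addr0. Qed.

Lemma mono_oneXi A : A != set0 -> gmul (mono K A) (oneXi K n) = mono K A.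
Proof. by move=> nzA; rewrite mul_oneXi gmul_mono -setI_eq0 setIT (negPf nzA) addr0. Qed.

Lemma gdel_oneXi_mul i f :
  gdel i (gmul (oneXi K n) f) = gmul (gdel i Xi) f + gmul (oneXi K n) (gdel i f).
Proof.
rewrite /oneXi (linD (gml f)) (linD (ld i)) (linD (gml (gdel i f))) !gmul1g.
rewrite (gdel_gmul _ _ (@hom_mono K m setT)) cardsT card_ord.
by rewrite /par /= oddM /= scale1r addrCA.
Qed.

Lemma gdelXi i : gdel i Xi = (-1) ^+ ninv [set i] (setT :\ i) *: mono K (setT :\ i).
Proof. by rewrite gdel_mono inE. Qed.

Lemma T_E i f : T i f = gmul (oneXi K n) (gdel i f).
Proof. by rewrite comp_lfunE lmulE delE. Qed.

Lemma setTD1_neq0 i : (setT :\ i : {set 'I_m}) != set0.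
Proof.
rewrite -card_gt0; have := cardsD1 i setT; rewrite cardsT card_ord inE /=.
by move: #|_ :\ i| => x; lia.
Qed.

(** T_i is not homogeneous for the degree, but del_i and Xi del_i have the odd
    degrees -1 and 2n - 1. *)
Lemma hpart_T i : hpart true (T i) = T i.
Proof.
have -> : T i = del K i + (lmul Xi \o del K i)%VF.
  by apply/lfunP=> f; rewrite add_lfunE T_E comp_lfunE lmulE delE oneXi_mul.
rewrite (linD (hpart_is_linear true)); congr (_ + _).
  exact: superder_hpart (superder_del K i).
have := superder_hpart (superder_lmul (@hom_mono K m setT) (superder_del K i)).
by rewrite parD /par cardsT card_ord /= oddM.
Qed.

(** A product of Xi with any non-constant monomial vanishes, so (1 + Xi) acts as
    the identity on del_i Xi; what remains of T_i (T_i f) contains del_i twice. *)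
Lemma sbracket_T i : sbracket (T i) (T i) = 2 *: (lmul (gdel i Xi) \o del K i)%VF.
Proof.
rewrite (sbracketE (hpart_T i) (hpart_T i)); apply/lfunP=> f.
rewrite add_lfunE opp_lfunE !scale_lfunE !comp_lfunE !(lmulE, delE).
rewrite gdel_oneXi_mul (linD (gmr _)) -gmulA gdelXi (linZ (gmr _)) oneXi_mono ?setTD1_neq0 //.
have -> : gdel i (gdel i f) = 0.
  have /eqP := gdelC i i f; rewrite -addr_eq0 -mulr2n -scaler_nat scaler_eq0 pnatr_eq0.
  by move/eqP.
by rewrite !(lin0 (gmr _)) addr0 scaleN1r opprK scaler_nat.
Qed.

(** Only the derivative of the coefficient survives: the second-order terms
    cancel because del_c and del_i anticommute, and the term where del_i hits Xi
    vanishes because xi_c divides both coefficients. *)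
Lemma sbracket_T_lower c i A : A != set0 -> c \notin A -> c != i ->
  sbracket (T c) (lmul (mono K (c |: A)) \o del K i)%VF =
    (-1) ^+ ninv [set c] A *: (lmul (mono K A) \o del K i)%VF.
Proof.
move=> nzA ncA nci.
have sX := superder_lmul (@hom_mono K m (c |: A)) (superder_del K i).
rewrite (sbracketE (hpart_T c) (superder_hpart sX)); apply/lfunP=> f.
rewrite add_lfunE opp_lfunE !scale_lfunE !comp_lfunE !(lmulE, delE).
have nzcA : c |: A != set0 by apply/set0Pn; exists c; rewrite setU11.
rewrite (gdel_gmul _ _ (@hom_mono K m (c |: A))) gdel_oneXi_mul !(linD (gmr _)).
rewrite (linZ (gmr _)) -!gmulA oneXi_mono // mono_oneXi // gdelXi (linZ (gmr _)) gmul_mono.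
have -> : [disjoint c |: A & setT :\ i] = false.
  by apply/negbTE; rewrite -setI_eq0; apply/set0Pn; exists c; rewrite !inE eqxx nci.
rewrite scaler0 (lin0 (gml _)) add0r gdel_monoU1 // (linZ (gmr _)) oneXi_mono //.
rewrite (linZ (gml _)) gdelC (linN (gmr _)) scalerN -addrA -opprD -scalerDl.
rewrite (_ : (-1) ^+ par _ + _ = 0) ?scale0r ?subr0 //.
by rewrite parD /=; case: (par _) => /=; ring.
Qed.

(** Descending induction on the coefficient xi_A, from the product of all the
    generators but xi_j down to A = {i}. *)
Lemma T_generates_X s i j : (brv s s <= s)%VS -> (forall c, T c \in s) -> i != j ->
  (lmul (xi K i) \o del K j)%VF \in s.
Proof.
move=> /brvP brs sT nij; rewrite /xi.
have nz2 : 2 != 0 :> K by rewrite pnatr_eq0.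
(* A contains i, so it never becomes empty and (1 + Xi) xi_A = xi_A. *)
suffices all_A A : i \in A -> j \notin A -> (lmul (mono K A) \o del K j)%VF \in s.
  by apply: all_A; rewrite !inE // eq_sym.
have [p] := ubnP #|~: A|; elim: p A => // p IHp A le_p iA njA.
have [eA|] := eqVneq A (setT :\ j).
  have := brs _ _ (sT j) (sT j); rewrite sbracket_T gdelXi -eA.
  rewrite (linZ (lmul_del_is_linear j)) scalerA rpredZeq mulf_eq0 (negPf nz2).
  by rewrite signr_eq0.
move=> nA; have [c] : exists c, c \in (setT :\ j) :\: A.
  apply/set0Pn; rewrite setD_eq0; apply: contra nA => sub.
  rewrite eqEsubset sub andbT; apply/subsetP=> x xA.
  by rewrite !inE andbT; apply: contraTneq xA => ->.
rewrite !inE andbT => /andP[ncA ncj].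
have nzA : A != set0 by apply/set0Pn; exists i.
have := brs _ _ (sT c) (IHp (c |: A) _ _ _).
rewrite sbracket_T_lower // rpredZeq signr_eq0 /=; apply.
- by move: le_p; rewrite (cardsD1 c) inE ncA setCU setIC -setDE.
- by rewrite inE iA orbT.
by rewrite !inE negb_or eq_sym ncj.
Qed.

Theorem tsvect_not_solvable s : (brv s s <= s)%VS ->
  (@tsvect_ K n (-1) <= s)%VS -> ~ lie_solvable s.
Proof.
move=> brs sub.
have sT c : T c \in s.
  apply: (subvP sub); rewrite /tsvect_ eqxx.
  by apply: (subvP (sumv_sup c isT (subvv _))); apply: memv_line.
have m_gt1 : (1 < m)%N by lia.
have m_gt0 : (0 < m)%N by lia.
have n01 : Ordinal m_gt0 != Ordinal m_gt1 by [].
by apply: (not_solvable_sl2 n01 brs); apply: T_generates_X.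
Qed.

End Deformed.

(** * Maximal solvable subsuperalgebras containing the component of degree -1 *)

From mathcomp Require Import reals complex.

Theorem proposition5p2 (R : realType) :
  [/\ forall (n : nat) (s0 : {vspace gl R[i] n}), (2 < n)%N ->
        maximal_solvable_subalgebra (vect_ R[i] n 0) s0 ->
        maximal_solvable (vect_ R[i] n) (vect R[i] n)
          (prolong (vect_ R[i] n) (vect_ R[i] n (-1)) s0),
      forall (n : nat) (s0 : {vspace gl R[i] n}), (2 < n)%N ->
        maximal_solvable_subalgebra (svect_ R[i] n 0) s0 ->
        maximal_solvable (svect_ R[i] n) (svect R[i] n)
          (prolong (svect_ R[i] n) (svect_ R[i] n (-1)) s0),
      forall (k l : nat) (s0 : {vspace gl R[i] (k + k + l)}), (4 < k + k + l)%N ->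
        maximal_solvable_subalgebra (ham_alg_ R[i] k l 0) s0 ->
        maximal_solvable (ham_alg_ R[i] k l) (ham_alg R[i] k l)
          (prolong (ham_alg_ R[i] k l) (ham_alg_ R[i] k l (-1)) s0)
    & forall n : nat, (2 <= n)%N ->
        ~ exists s : {vspace gl R[i] (2 * n)},
            maximal_solvable (@tsvect_ R[i] n) (tsvect R[i] n) s /\
            (s :&: @tsvect_ R[i] n (-1))%VS = @tsvect_ R[i] n (-1)].
Proof.
split=> [n s0 n_gt2|n s0 n_gt2|k l s0 n_gt4|n n_ge2 [s [[[_ [_ brs] _ sol] _] /capv_idPr sub]]].
- exact: vect_prolong (ltnW (ltnW n_gt2)).
- exact: svect_prolong (ltnW (ltnW n_gt2)).
- exact: ham_prolong (leq_ltn_trans (leq0n 4) n_gt4).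
exact: tsvect_not_solvable n_ge2 s brs sub sol.
Qed.
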